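(* Let $d\ge1$ be an integer, and let $\mathcal{R}_d$ be the collection of aligned rectangles in $\mathbb{R}^d$ with non-empty interior and all vertices in $\mathbb{Z}^d$ (aligned means all faces are parallel to coordinate hyperplanes). Then the set of $2d$ to $d$ cubical cut and project sets which are $\mathrm{LR}_\Omega$ with respect to $\mathcal{R}_d$ has Hausdorff dimension equal to $d$. Here the sets are parametrized by the choice of the physical space: the assertion is that the set of $(\alpha_{ij})_{1\le i,j\le d}\in\mathbb{R}^{d^2}$ for which the subspace $$E=\{(x,L(x)):x\in\mathbb{R}^d\}\subseteq\mathbb{R}^{2d},\qquad L(x)_i=\sum_{j=1}^d\alpha_{ij}x_j\quad(1\le i\le d),$$ defines a $2d$ to $d$ cubical cut and project set which is $\mathrm{LR}_\Omega$ with respect to $\mathcal{R}_d$ has Hausdorff dimension $d$.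
   Context: **Cut and project sets.** Let $k>d\ge1$ be integers and $e_1,\dots,e_k$ the standard basis of $\mathbb{R}^k$. Let $E\subseteq\mathbb{R}^k$ be a $d$-dimensional subspace (the physical space), $F_\pi\subseteq\mathbb{R}^k$ a subspace complementary to $E$, and $\pi:\mathbb{R}^k\to E$ the projection with respect to $\mathbb{R}^k=E+F_\pi$; it is assumed that $\pi|_{\mathbb{Z}^k}$ is injective. For a set (window) $\mathcal{W}_\pi\subseteq F_\pi$ put $\mathcal{S}=\mathcal{W}_\pi+E$ (the strip). For $s\in\mathbb{R}^k/\mathbb{Z}^k$, the set $Y=Y_s=\pi(\mathcal{S}\cap(\mathbb{Z}^k+s))\subseteq E$ is called a $k$ to $d$ cut and project set. It is regular if $(\mathbb{Z}^k+s)\cap\partial\mathcal{S}=\emptyset$. $E$ is totally irrational if its canonical projection to $\mathbb{R}^k/\mathbb{Z}^k$ is dense. $Y$ is aperiodic if the only $x\in E$ with $Y+x=Y$ is $x=0$. Let $F_\rho=\{0\}\times\mathbb{R}^{k-d}$; it is assumed that $E$ is complementary to $F_\rho$ (so $E$ is the graph of a linear map $\mathbb{R}^d\to\mathbb{R}^{k-d}$). Let $\rho:\mathbb{R}^k\to E$ be the projection with respect to $\mathbb{R}^k=E+F_\rho$. Put $\mathcal{W}=\mathcal{S}\cap F_\rho$ (also called the window; $\mathcal{S}=\mathcal{W}+E$). The window is cubical if $\mathcal{W}=\{\sum_{i=d+1}^k t_ie_i:0\le t_i<1\}$. A cubical cut and project set is a regular, totally irrational (meaning $E$ is totally irrational),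 aperiodic cut and project set with cubical window. **Patterns.** Subsets of $\mathbb{R}^d$ are regarded as subsets of $\langle e_1,\dots,e_d\rangle_{\mathbb{R}}\subseteq\mathbb{R}^k$, and as subsets of $E$ via $\rho$. For $y\in Y$, $\tilde y\in\mathbb{Z}^k$ is the unique point with $\pi(\tilde y+s)=y$. For bounded $\Omega\subseteq\mathbb{R}^d$ and $y\in Y$, the patch of shape $\Omega$ at $y$ is $P(y,\Omega)=\{y'\in Y:\rho(\tilde y'-\tilde y)\in\rho(\Omega)\}$. Patches $P(y_1,\Omega)$ and $P(y_2,\Omega)$ are equivalent if $P(y_1,\Omega)=P(y_2,\Omega)+y_1-y_2$; a pattern of shape $\Omega$ is an equivalence class of patches. A pattern of shape $\Omega$ occurs in a region $R\subseteq\mathbb{R}^d$ if there is $y\in Y\cap\rho(R)$ such that $P(y,\Omega)$ belongs to that class. **$\mathrm{LR}_\Omega$.** For a collection $\mathcal{A}$ of bounded subsets of $\mathbb{R}^d$, $Y$ is $\mathrm{LR}_\Omega$ with respect to $\mathcal{A}$ if there is a constant $C>0$ such that for every set $\Omega\in\mathcal{A}$, every pattern of shape $\Omega$ in $Y$ occurs in every translate of $C\Omega$ in $\mathbb{R}^d$. (The subscript $\Omega$ in the name $\mathrm{LR}_\Omega$ is only notation.)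
   Formalization: LR_Ω is required only for rectangles in R_d that contain the origin; with all of R_d, the shapes n+[0,1]^d have patterns of arbitrarily small frequency (u_1<{L_1(n)}), so no cubical set is LR_Ω and the set would be empty. *)

(* Defs.v *)
From HB Require Import structures.
From mathcomp Require Import all_boot all_order all_algebra.
From mathcomp Require Import all_classical all_reals all_analysis.

Set Implicit Arguments.
Unset Strict Implicit.
Unset Printing Implicit Defensive.

Import Order.TTheory GRing.Theory Num.Theory.
Import numFieldNormedType.Exports.

Local Open Scope classical_set_scope.
Local Open Scope ring_scope.

Section HausdorffDimension.
Context {R : realType} {T : Type} (dist : T -> T -> R).

(* The added 0 only matters for U = set0, where the supremum would be -oo. *)
Definition diam (U : set T) : \bar R :=
  ereal_sup (0%E |` [set (dist p.1 p.2)%:E | p in U `*` U]).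

(* The convention 0 `^ 0 = 1 gives the right value for a singleton at s = 0,
   hence the separate treatment of the empty set. *)
Definition gauge_term (s : R) (U : set T) : \bar R :=
  if pselect (U = set0) then 0%E else (diam U `^ s)%E.

Definition hausdorff_premeasure (s delta : R) (A : set T) : \bar R :=
  ereal_inf [set (\sum_(0 <= i <oo) gauge_term s (U i))%E |
    U in [set U : nat -> set T |
      A `<=` \bigcup_i U i /\ forall i, (diam (U i) <= delta%:E)%E]].

Definition hausdorff_measure (s : R) (A : set T) : \bar R :=
  ereal_sup [set hausdorff_premeasure s delta A | delta in [set x : R | 0 < x]].

Definition hausdorff_dim (A : set T) : \bar R :=
  ereal_inf [set s%:E | s in [set s : R | 0 <= s /\ hausdorff_measure s A = 0%E]].

End HausdorffDimension.

Definition euclid_dist {R : realType} {m n : nat} (A B : 'M[R]_(m, n)) : R :=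
  Num.sqrt (\sum_i \sum_j (A i j - B i j) ^+ 2).

Section Torus.
Variables (R : realType) (k : nat).
Implicit Types x y z : 'cV[R]_k.

Definition lattice : set 'cV[R]_k := [set x | x \is a mxOver Num.int].

Definition lattice_equiv x y : bool := x - y \is a mxOver Num.int.

Lemma lattice_equiv_refl : reflexive lattice_equiv.
Proof. by move=> x; apply/mxOverP => i j; rewrite !mxE subrr rpred0. Qed.

Lemma lattice_equiv_sym : symmetric lattice_equiv.
Proof.
move=> x y; apply/mxOverP/mxOverP => xy i j;
  by have := xy i j; rewrite !mxE -opprB rpredN.
Qed.

Lemma lattice_equiv_trans : transitive lattice_equiv.
Proof.
move=> y x z /mxOverP xy /mxOverP yz; apply/mxOverP => i j.
have := rpredD (xy i j) (yz i j).
by rewrite !mxE addrA subrK.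
Qed.

Canonical lattice_equiv_rel := EquivRel lattice_equiv
  lattice_equiv_refl lattice_equiv_sym lattice_equiv_trans.

Definition torus := {eq_quot lattice_equiv}%qT.

Definition torus_proj x : quotient_topology torus := (\pi_torus x)%qT.

End Torus.

Section CutAndProject.
Variables (R : realType) (d m : nat).
Local Notation space := 'cV[R]_(d + m).
Implicit Types (E F : {vspace space}) (x y z : space) (Omega : set 'cV[R]_d).

Definition complementary E F : Prop :=
  (E + F = fullv)%VS /\ (E :&: F = 0)%VS.

(* daddv_pi E F is the linear projection onto E along F when E and F are
   complementary. *)

Definition F_rho : {vspace space} :=
  limg (linfun (mulmx (col_mx (0 : 'M[R]_(d, m)) 1%:M))).

Lemma mem_F_rho x : x \in F_rho <-> exists y : 'cV[R]_m, x = col_mx 0 y.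
Proof.
split=> [/memv_imgP[y _ ->]|[y ->]].
  by exists y; rewrite lfunE /= mul_col_mx mul0mx mul1mx.
apply/memv_imgP; exists y; first exact: memvf.
by rewrite lfunE /= mul_col_mx mul0mx mul1mx.
Qed.

Record cps := Cps {
  physical : {vspace space};
  F_pi : {vspace space};
  window_pi : set space;
  shift : space
}.

Implicit Type Y : cps.

Definition proj_pi Y : space -> space := daddv_pi (physical Y) (F_pi Y).
Definition proj_rho Y : space -> space := daddv_pi (physical Y) F_rho.

Definition strip Y : set space :=
  [set w + e | w in window_pi Y & e in [set` physical Y]].

Definition shifted_lattice Y : set space :=
  [set z + shift Y | z in @lattice R (d + m)].

Definition points Y : set space :=
  proj_pi Y @` (strip Y `&` shifted_lattice Y).

Definition is_cut_and_project Y : Prop :=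
  [/\ \dim (physical Y) = d,
      complementary (physical Y) (F_pi Y),
      complementary (physical Y) F_rho,
      {in @lattice R (d + m) &, injective (proj_pi Y)}
    & window_pi Y `<=` [set` F_pi Y]].

Definition regular Y : Prop :=
  shifted_lattice Y `&` (closure (strip Y) `\` (strip Y)^°) = set0.

Definition totally_irrational E : Prop :=
  dense (@torus_proj R (d + m) @` [set` E]).

Definition aperiodic Y : Prop :=
  forall x, x \in physical Y -> [set y + x | y in points Y] = points Y -> x = 0.

Definition window Y : set space := strip Y `&` [set` F_rho].

Definition cubical_window Y : Prop :=
  window Y = [set \sum_(i < m) t i *: delta_mx (rshift d i) 0 |
    t in [set t : 'I_m -> R | forall i, 0 <= t i < 1]].

Definition cubical Y : Prop :=
  [/\ is_cut_and_project Y, regular Y, totally_irrational (physical Y),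
      aperiodic Y & cubical_window Y].

(* The point of Z^k above y; unique for y \in points Y by injectivity of
   proj_pi on the lattice, and irrelevant for other y. *)
Definition lift_pt Y y : space :=
  xget 0 [set z | lattice z /\ proj_pi Y (z + shift Y) = y].

Definition embed (x : 'cV[R]_d) : space := col_mx x 0.

Definition rho_set Y Omega : set space := proj_rho Y @` (embed @` Omega).

Definition patch Y y Omega : set space :=
  [set y' | points Y y' /\
     rho_set Y Omega (proj_rho Y (lift_pt Y y' - lift_pt Y y))].

Definition patch_equiv Y Omega y1 y2 : Prop :=
  patch Y y1 Omega = [set y + y1 - y2 | y in patch Y y2 Omega].

(* A pattern is represented by any base point y of one of its patches. *)
Definition pattern_occurs Y Omega y (S : set 'cV[R]_d) : Prop :=
  exists y', [/\ points Y y', rho_set Y S y' & patch_equiv Y Omega y' y].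

Definition LR_Omega Y (A : set (set 'cV[R]_d)) : Prop :=
  exists2 C : R, 0 < C &
    forall Omega, A Omega -> forall y, points Y y -> forall t : 'cV[R]_d,
      pattern_occurs Y Omega y [set C *: w + t | w in Omega].

End CutAndProject.

Section Rectangles.
Variables (R : realType) (d : nat).
Implicit Types a b v : 'cV[R]_d.

Definition box a b : set 'cV[R]_d := [set x | forall i, a i 0 <= x i 0 <= b i 0].

Definition box_vertices a b : set 'cV[R]_d :=
  [set v | forall i, v i 0 = a i 0 \/ v i 0 = b i 0].

Definition integer_rectangles : set (set 'cV[R]_d) :=
  [set Omega | exists a b,
     [/\ Omega = box a b, Omega^° !=set0 & box_vertices a b `<=` @lattice R d]].

(* Shapes are required to contain the origin, i.e. the patch of shape Omega at
   y contains y.  Over all of integer_rectangles the property LR_Omega holds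
   for no cubical set: it would apply to n + [0, 1]^d for every n in Z^d, and
   patches of that shape distinguish the two possible values of
   (lift over p + n) - (lift over p), one of which only occurs for lifts within
   the distance from L_i(n) to Z of the boundary of the window.  That distance
   takes arbitrarily small nonzero values, while C * Omega keeps its size. *)
Definition pointed_integer_rectangles : set (set 'cV[R]_d) :=
  integer_rectangles `&` [set Omega | Omega 0].

End Rectangles.

(* The parameters alpha for which the graph of x |-> alpha *m x is the physical
   space of some cubical cut and project set with the property. *)
Definition LR_cubical_params (R : realType) (d : nat) : set 'M[R]_d :=
  [set alpha | exists Y : cps R d d,
     [/\ [set` physical Y] = [set col_mx x (alpha *m x) | x in setT],
         cubical Y & LR_Omega Y (@pointed_integer_rectangles R d)]].

(* Main.v *)
Require Import Defs.
From HB Require Import structures.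
From mathcomp Require Import all_boot all_order all_algebra.
From mathcomp Require Import all_classical all_reals all_analysis.
From mathcomp Require Import ring lra zify.

(** Write x* for the F_rho-coordinate y - alpha x of a point (x, y), so that the
strip is x* in [0, 1)^d.  Two patches of shape Omega at lattice points z1, z2
are equivalent iff, for every lattice vector v with horizontal part in Omega,
z1* + v* and z2* + v* are simultaneously in [0, 1)^d.

Upper bound.  Every pattern of shape [0, N]^d occurs in a cube of side C N, so
there are O(N^d) of them.  On the other hand their number is at least the
product over i of the number of values mod 1 of the i-th linear form on
[0, N]^d, each factor being at least N by total irrationality, and at least
N^2 when 1 and two entries of the i-th row are independent over Q.  Hence the
i-th row is r + t q with r, q rational vectors and t real: the parameters lie
in a countable union of Lipschitz images of R^d.

Lower bound.  For alpha = diag(a_1, ..., a_d) with all a_i badly approximable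
everything splits into one-dimensional problems.  The breakpoints a_i p mod 1,
p in an interval of length l, are separated by c / l, and any c l^-1-interval
of the circle is visited by every run of O(l) consecutive multiples of a_i.
Products of M-adic Cantor sets of badly approximable numbers have dimension
tending to d with M: given a cover with small sum of diam^s, choose nested
M-adic cubes, avoiding rationals, which keep the total weight of the members of
the cover that they meet below the weight of a single member of their own
size. *)

Set Implicit Arguments.
Unset Strict Implicit.
Unset Printing Implicit Defensive.

Import Order.TTheory GRing.Theory Num.Theory.
Import numFieldNormedType.Exports.

Local Open Scope classical_set_scope.
Local Open Scope ring_scope.

(** * Diophantine approximation *)

Section DiophantineApproximation.
Variable R : realType.
Implicit Types (a c : R).

Definition badly_approximable c a : Prop :=
  forall p q : int, 0 < q -> c / q%:~R <= `|q%:~R * a - p%:~R|.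

(** Pigeonhole: of the Q + 1 fractional parts of i a, 0 <= i <= Q, two lie in the same interval [g /
    Q, (g + 1) / Q); the difference of their indices is the denominator. *)
Lemma dirichlet a (Q : nat) : (0 < Q)%N ->
  exists (p : int) (q : nat), (0 < q <= Q)%N /\ `|q%:R * a - p%:~R| < Q%:R^-1.
Proof.
move=> Q0; have QR : 0 < Q%:R :> R by rewrite ltr0n.
pose fr (i : nat) : R := i%:R * a - (Num.floor (i%:R * a))%:~R.
have fr0 i : 0 <= fr i < 1.
  by have := Num.Theory.floor_itv (i%:R * a); rewrite intrD /fr => /andP[]; lra.
pose g (i : nat) : nat := `|Num.floor (Q%:R * fr i)|%N.
have gE i : (g i)%:R <= Q%:R * fr i < (g i)%:R + 1.
  have /andP[f0 f1] := fr0 i.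
  have pos : 0 <= Num.floor (Q%:R * fr i) by rewrite floor_ge_int_tmp mulr_ge0 // ltW.
  have := Num.Theory.floor_itv (Q%:R * fr i).
  by rewrite /g intrD -[in X in X -> _](gez0_abs pos).
have gQ i : (g i < Q)%N.
  have /andP[g1 _] := gE i; rewrite -(ltr_nat R); apply: (le_lt_trans g1).
  by rewrite gtr_pMr //; have /andP[] := fr0 i.
pose h (i : 'I_Q.+1) : 'I_Q := Ordinal (gQ i).
have /injectivePn [i [j ij hij]] : ~~ injectiveb h.
  apply/negP => /injectiveP /leq_card; rewrite !card_ord; lia.
wlog lij : i j ij hij / (i < j)%N.
  move=> W; have [l|l|e] := ltngtP i j; [exact: (W i j)|apply: (W j i) => //|].
    by rewrite eq_sym.
  by move/val_inj: e ij => ->; rewrite eqxx.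
exists (Num.floor (j%:R * a) - Num.floor (i%:R * a)), (j - i)%N.
split; first by have := ltn_ord j; lia.
have e : g i = g j by exact: (congr1 val hij).
have gi := gE i; have gj := gE j; rewrite e in gi.
move: gi gj => {e}; move: (g j) => gj gi1 gj1.
rewrite natrB; last by rewrite ltnW.
rewrite intrB.
clear hij h gQ gE.
rewrite [X in `|X|](_ : _ = fr j - fr i); last first.
  by rewrite /fr; move: (Num.floor _)%:~R (Num.floor _)%:~R => x y; ring.
rewrite -(ltr_pM2l QR) mulfV ?gt_eqF // -[X in X * `|_|]ger0_norm ?ltW // -normrM.
rewrite mulrBr ltr_norml; lra.
Qed.

(** Dividing p and q by their gcd also divides the error [|q a - p|] by it. *)
Lemma dirichlet_coprime a (Q : nat) : (0 < Q)%N ->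
  exists p q : int, [/\ 0 < q, q <= Q%:Z, coprimez p q &
    `|q%:~R * a - p%:~R| < Q%:R^-1].
Proof.
move=> Q0; have [p [n [/andP[n0 nQ]]]] := dirichlet a Q0.
rewrite -[n%:R]/((Posz n)%:~R); have : 0 < Posz n by [].
have : Posz n <= Q%:Z by [].
move: (Posz n) => q qQ q0 apq.
pose g : int := gcdz p q.
have /dvdzP[p' pE] : (g %| p)%Z by apply: dvdz_gcdl.
have /dvdzP[q' qE] : (g %| q)%Z by apply: dvdz_gcdr.
have g0 : 0 <= g by [].
have q'0 : 0 < q' by nia.
have g1 : 0 < g by nia.
exists p', q'; split => //; first by nia.
  have := mulz_gcdl p' q' g; rewrite -pE -qE gez0_abs // -/g => e.
  by apply/eqP; move: (gcdz p' q') e => G e; nia.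
apply: le_lt_trans apq; rewrite pE qE !intrM.
rewrite [X in _ <= `|X|](_ : _ = g%:~R * (q'%:~R * a - p'%:~R)); last by ring.
by rewrite normrM ler_peMl // ger0_norm ?ler0z // ler1z.
Qed.

(* If p / q is a reduced Dirichlet approximation of a then n a mod 1, for n
   ranging over q consecutive integers, is within 1 / Q of a permutation of the
   multiples of 1 / q, and q >= c Q because a is badly approximable. *)
Lemma inhomogeneous_approximation c a (Q : nat) (g t : R) :
  0 < c -> badly_approximable c a -> (0 < Q)%N ->
  exists n m : int, t <= n%:~R <= t + Q%:R + 1 /\
    `|m%:~R - a * n%:~R - g| <= 2 / (c * Q%:R).
Proof.
move=> c0 ba Q0; have QR : 0 < Q%:R :> R by rewrite ltr0n.
have [p [q [q0 qQ cpq apq]]] := dirichlet_coprime a Q0.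
have qR : 0 < q%:~R :> R by rewrite ltr0z.
have qQR : q%:~R <= Q%:R :> R by rewrite -[Q%:R]/((Posz Q)%:~R) ler_int.
have cQq : c * Q%:R <= q%:~R.
  have := le_lt_trans (ba p q q0) apq.
  by rewrite ltr_pdivrMr // mulrC ltr_pdivlMr // => /ltW.
pose n0 := Num.ceil t.
have /andP[n0t n0t1] : t <= n0%:~R <= t + 1.
  by have := Num.Theory.ceil_itv t; rewrite /n0 intrB => /andP[]; lra.
pose k := Num.floor (q%:~R * (- a * n0%:~R - g)).
have /andP[k1 k2] : k%:~R <= q%:~R * (- a * n0%:~R - g) <= k%:~R + 1.
  by have := Num.Theory.floor_itv (q%:~R * (- a * n0%:~R - g));
    rewrite intrD -/k => /andP[]; lra.
have [u [v uv]] := Bezoutz p q.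
have {}uv : u * p + v * q = 1 by rewrite uv; apply/eqP.
(* As u p = 1 mod q, p j = k mod q, so (p j - k) / q is an integer m. Then q (m - a (n0 + j) - g) is
   the rounding error of [k] minus j (q a - p), and both are at most 1 in absolute value. *)
pose j := ((u * k) %% q)%Z.
have j0 : 0 <= j by rewrite modz_ge0 // gt_eqF.
have jq : j < q by rewrite ltz_pmod.
have [m mE] : exists m : int, q * m = p * j - k.
  exists (p * - ((u * k) %/ q)%Z - v * k).
  rewrite /j; have := divz_eq (u * k) q.
  set D := (_ %/ _)%Z; set J := (_ %% _)%Z => e.
  have -> : J = u * k - D * q by rewrite e; ring.
  by transitivity (p * (u * k - D * q) - (u * p + v * q) * k);
    [ring|rewrite uv mul1r].
exists (n0 + j), m; split.
  rewrite intrD; have : 0 <= j%:~R :> R by rewrite ler0z.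
  have : j%:~R <= q%:~R :> R by rewrite ler_int ltW.
  lra.
have mR : q%:~R * m%:~R = p%:~R * j%:~R - k%:~R :> R by rewrite -!intrM -intrB mE.
have b1 : `|j%:~R * (q%:~R * a - p%:~R)| <= 1 :> R.
  rewrite normrM ger0_norm ?ler0z //.
  apply: (@le_trans _ _ (Q%:R * Q%:R^-1)); last by rewrite mulfV ?gt_eqF.
  apply: ler_pM => //; [by rewrite ler0z| |exact: ltW].
  by apply: le_trans qQR; rewrite ler_int ltW.
have b2 : q%:~R * `|m%:~R - a * (n0 + j)%:~R - g| <= 2.
  rewrite -[X in X * _](ger0_norm (ltW qR)) -normrM intrD.
  rewrite [X in `|X|](_ : _ = (q%:~R * (- a * n0%:~R - g) - k%:~R)
    - j%:~R * (q%:~R * a - p%:~R)); last by rewrite !mulrDr mR; ring.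
  apply: le_trans (ler_normB _ _) _.
  have : `|q%:~R * (- a * n0%:~R - g) - k%:~R| <= 1 by rewrite ler_norml; lra.
  by move=> ?; lra.
rewrite ler_pdivlMr ?mulr_gt0 // mulrC; apply: le_trans b2.
by apply: ler_wpM2r.
Qed.

(** Used for differences of two breakpoints a p - k with p in an interval of length l. For p = 0 the
    value is an integer, which is where [c <= 1] enters. *)
Lemma badly_approximable_gap c a (l p k : int) : 0 < c <= 1 ->
  badly_approximable c a -> 0 < l -> `|p| <= l ->
  a * p%:~R - k%:~R = 0 \/ c / l%:~R <= `|a * p%:~R - k%:~R|.
Proof.
move=> /andP[c0 c1] ba l0 pl.
have lR : 1 <= l%:~R :> R by rewrite ler1z.
have cl : c / l%:~R <= 1 by rewrite ler_pdivrMr ?mul1r //; lra.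
wlog p0 : p k pl / 0 <= p.
  move=> W; have [/W|p0] := leP 0 p; first exact.
  have := W (- p) (- k); rewrite normrN oppr_ge0 => /(_ pl (ltW p0)).
  by rewrite !intrN mulrN -opprB opprK normrN addrC; case=> [?|?]; [left; lra|right].
have [p1|p1] := ltP 0 p.
  right; rewrite [a * _]mulrC; apply: le_trans (ba k p p1).
  rewrite ler_pM2l // lef_pV2 ?posrE ?ltr0z // ler_int.
  by rewrite ger0_norm in pl.
have -> : p = 0 by lia.
rewrite mulr0 sub0r normrN; have [->|k0] := eqVneq k 0; [by left; rewrite oppr0|].
by right; apply: le_trans cl _; rewrite -intr_norm ler1z; lia.
Qed.

(** The outcome of the tests depends only on the position of [x] among the breakpoints a p - k.
    These are c / l apart, so the outcome persists on an interval of length c / (2 l) next to [x],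
    and inhomogeneous approximation puts some m + s - a n into that interval with n in a range of
    length O(l). *)
Lemma linear_recurrence c a (s x t : R) (lo hi : int) :
  0 < c <= 1 -> badly_approximable c a -> lo <= 0 <= hi -> lo < hi ->
  0 <= x < 1 ->
  exists n m : int,
    t <= n%:~R <= t + (8 / c ^+ 2 + 2) * (hi - lo)%:~R /\
    forall p k : int, lo <= p <= hi ->
      (0 <= x + (k%:~R - a * p%:~R) < 1) =
      (0 <= m%:~R + s - a * n%:~R + (k%:~R - a * p%:~R) < 1).
Proof.
move=> cP ba /andP[lo0 hi0] lohi /andP[x0 x1]; have /andP[c0 c1] := cP.
pose l := hi - lo; have l0 : 0 < l by rewrite subr_gt0.
have lR : 1 <= l%:~R :> R by rewrite ler1z.
have lp : 0 < l%:~R :> R by rewrite ltr0z.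
pose e := c / l%:~R / 2.
have e0 : 0 < e by rewrite !divr_gt0.
(* Distinct breakpoints are at least 2 e apart, so (x - e, x + e] contains at most one. If it lies
   in (x, x + e], the interval is taken to the left of [x], otherwise to the right. *)
have [y yP] : exists y, forall x', y < x' < y + e ->
    forall p k : int, lo <= p <= hi ->
      (0 <= x + (k%:~R - a * p%:~R)) = (0 <= x' + (k%:~R - a * p%:~R)).
  have [[p0 [k0 [p0l b1 b2]]]|nb] := pselect (exists p0 k0 : int,
    [/\ lo <= p0 <= hi, x < a * p0%:~R - k0%:~R & a * p0%:~R - k0%:~R <= x + e]).
  - exists (x - e) => x' /andP[x'1 x'2] p k pl.
    have := @badly_approximable_gap c a l (p0 - p) (k0 - k) cP ba l0 _.
    have -> : `|p0 - p| <= l by rewrite /l; lia.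
    move=> /(_ isT); rewrite [(p0 - p)%:~R]intrB [(k0 - k)%:~R]intrB => gap.
    apply/idP/idP => h; first last; first by lra.
    case: gap => [gap|]; first by lra.
    rewrite -/e (_ : c / l%:~R = e * 2); last by rewrite /e; field; rewrite gt_eqF.
    by rewrite ler_normr => /orP[] ?; lra.
  - exists x => x' /andP[x'1 x'2] p k pl.
    apply/idP/idP => h; first by lra.
    rewrite leNgt; apply/negP => h'; apply: nb.
    by exists p, k; split=> //; lra.
(* Q > 8 l / c^2 makes the error 2 / (c Q) smaller than e / 2 = c / (4 l), so that aiming at the
   midpoint y + e / 2 lands inside the interval. *)
pose Q := `|Num.floor (8 * l%:~R / c ^+ 2)|.+1.
have c20 : 0 < c ^+ 2 by rewrite exprn_gt0.
have fl0 : 0 <= Num.floor (8 * l%:~R / c ^+ 2).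
  by rewrite floor_ge_int_tmp divr_ge0 ?mulr_ge0 ?ltW.
have QE : Q%:R = (Num.floor (8 * l%:~R / c ^+ 2))%:~R + 1 :> R.
  by rewrite /Q -natr1 natr_absz ger0_norm.
have Q1 : 8 * l%:~R / c ^+ 2 < Q%:R by rewrite QE -intrD1 floorD1_gt.
have Q2 : Q%:R <= 8 * l%:~R / c ^+ 2 + 1 by rewrite QE lerD2r floor_le.
have Q0 : 0 < Q%:R :> R by rewrite ltr0n.
have [n [m [/andP[n1 n2] nm]]] :=
  @inhomogeneous_approximation c a Q (y + e / 2 - s) t c0 ba isT.
have eQ : 2 / (c * Q%:R) < e / 2.
  rewrite ltr_pdivrMr ?mulr_gt0 //.
  move: Q1; rewrite ltr_pdivrMr // => Q1.
  have -> : e / 2 * (c * Q%:R) = Q%:R * c ^+ 2 / (4 * l%:~R).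
    by rewrite /e; field; rewrite gt_eqF.
  by rewrite ltr_pdivlMr ?mulr_gt0 //; lra.
exists n, m; split.
  rewrite n1 /=; apply: (le_trans n2); rewrite -addrA lerD2l.
  have -> : (8 / c ^+ 2 + 2) * (hi - lo)%:~R = 8 * l%:~R / c ^+ 2 + 2 * l%:~R.
    by rewrite /l; field; rewrite gt_eqF.
  by lra.
have x'P : y < m%:~R + s - a * n%:~R < y + e.
  by move: (le_lt_trans nm eQ); rewrite ltr_norml; lra.
move=> p k pl; congr (_ && _); first exact: yP.
(* The upper test for [k] is the negation of the lower test for k - 1, so [yP] covers both. *)
have E (z : R) : (z < 1) = ~~ (0 <= z - 1) by rewrite subr_ge0 ltNge.
rewrite !E; congr (~~ _); have := yP _ x'P p (k - 1) pl; rewrite intrB.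
by rewrite -![_ + (k%:~R - _) - 1]addrA ![k%:~R - _ - 1]addrAC.
Qed.

End DiophantineApproximation.

Lemma badly_approximable_irrational (R : realType) (c a : R) (p q : int) :
  0 < c -> badly_approximable c a -> p%:~R + q%:~R * a = 0 -> q = 0.
Proof.
move=> c0 ba.
have pos (p' q' : int) : 0 < q' -> q'%:~R * a - p'%:~R <> 0.
  move=> q0 e; have := ba p' q' q0; rewrite e normr0 leNgt divr_gt0 //.
  by rewrite ltr0z.
have [q0|q0|//] := ltgtP q 0 => e.
  by case: (pos p (- q)); rewrite ?oppr_gt0 // intrN; lra.
by case: (pos (- p) q) => //; rewrite intrN; lra.
Qed.

(** * Cut and project sets over a graph *)

Section Lattice.
Variables (R : realType) (k : nat).
Implicit Types v w : 'cV[R]_k.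

Lemma latticeP v : lattice v <-> forall i, v i 0 \is a Num.int.
Proof.
split=> [/mxOverP vi i|vi]; first exact: vi.
by apply/mxOverP => i j; rewrite ord1.
Qed.

Lemma latticeD v w : lattice v -> lattice w -> lattice (v + w).
Proof. by move=> /latticeP vi /latticeP wi; apply/latticeP => i; rewrite mxE rpredD. Qed.

Lemma latticeN v : lattice v -> lattice (- v).
Proof. by move=> /latticeP vi; apply/latticeP => i; rewrite mxE rpredN. Qed.

Lemma latticeB v w : lattice v -> lattice w -> lattice (v - w).
Proof. by move=> lv lw; apply: latticeD => //; apply: latticeN. Qed.

Lemma latticeMn v n : lattice v -> lattice (v *+ n).
Proof.
move=> /latticeP vi; apply/latticeP => i.
by rewrite -scaler_nat mxE rpredM // natr_int.
Qed.

Lemma lattice_intr (n : 'I_k -> int) : lattice (\col_i (n i)%:~R : 'cV[R]_k).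
Proof. by apply/latticeP => i; rewrite mxE intr_int. Qed.

End Lattice.

Lemma lattice_col_mx (R : realType) (m n : nat) (x : 'cV[R]_m) (y : 'cV[R]_n) :
  lattice x -> lattice y -> lattice (col_mx x y).
Proof.
move=> /latticeP lx /latticeP ly; apply/latticeP => i.
by case: (split_ordP i) => j ->; rewrite ?col_mxEu ?col_mxEd.
Qed.

Lemma lattice_usubmx (R : realType) (m n : nat) (v : 'cV[R]_(m + n)) :
  lattice v -> lattice (usubmx v).
Proof. by move=> /latticeP lv; apply/latticeP => i; rewrite mxE. Qed.

Lemma lattice_dsubmx (R : realType) (m n : nat) (v : 'cV[R]_(m + n)) :
  lattice v -> lattice (dsubmx v).
Proof. by move=> /latticeP lv; apply/latticeP => i; rewrite mxE. Qed.

Lemma sum_delta_rshift (R : realType) (d m : nat) (t : 'I_m -> R) :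
  \sum_(i < m) t i *: delta_mx (rshift d i) 0 = col_mx 0 (\col_i t i) :> 'cV_(d + m).
Proof.
apply/matrixP => i j; rewrite ord1 summxE; case: (split_ordP i) => l ->.
  rewrite col_mxEu mxE big1 // => k _.
  by rewrite !mxE eq_lrshift /= mulr0.
rewrite col_mxEd mxE (bigD1 l) //= !mxE !eqxx mulr1 big1 ?addr0 // => k kl.
by rewrite !mxE eq_rshift eq_sym (negbTE kl) mulr0.
Qed.

Section GraphCutAndProject.
Variables (R : realType) (d m : nat) (alpha : 'M[R]_(m, d)) (Y : cps R d m).
Hypothesis physicalE :
  [set` physical Y] = [set col_mx x (alpha *m x) | x in setT].
Hypothesis cutY : is_cut_and_project Y.
Hypothesis cubeY : cubical_window Y.

Local Notation shiftY := (Defs.shift Y).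
Local Notation patch := (@Defs.patch R d m).

Definition star (v : 'cV[R]_(d + m)) : 'cV[R]_m :=
  dsubmx v - alpha *m usubmx v.

Definition unit_cube : set 'cV[R]_m := [set x | forall i, 0 <= x i 0 < 1].

Lemma starD v w : star (v + w) = star v + star w.
Proof. by apply/matrixP => i j; rewrite /star !linearD /= !mxE; ring. Qed.

Lemma starN v : star (- v) = - star v.
Proof. by apply/matrixP => i j; rewrite /star !linearN /= !mxE; ring. Qed.

Lemma star_col_mx x y : star (col_mx x y) = y - alpha *m x.
Proof. by rewrite /star col_mxKu col_mxKd. Qed.

Lemma mem_physical v : v \in physical Y <-> star v = 0.
Proof.
have -> : (v \in physical Y) = [set` physical Y] v :> Prop by [].
rewrite physicalE; split=> [[x _ <-]|/eqP]; first by rewrite star_col_mx subrr.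
by rewrite subr_eq0 => /eqP vE; exists (usubmx v) => //; rewrite -vE vsubmxK.
Qed.

Lemma graph_mem x : col_mx x (alpha *m x) \in physical Y.
Proof. by apply/mem_physical; rewrite star_col_mx subrr. Qed.

Lemma complementary_proj (E F : {vspace 'cV[R]_(d + m)}) e f :
  complementary E F -> e \in E -> f \in F -> daddv_pi E F (e + f) = e.
Proof.
move=> [EF EF0] eE fF; rewrite linearD /= daddv_pi_id //.
have := daddv_pi_add EF0 (_ : f \in (E + F)%VS); rewrite EF memvf => /(_ isT).
rewrite (@daddv_pi_id _ _ F E) 1?capvC // => /(canRL (addrK _)).
by rewrite subrr => ->; rewrite addr0.
Qed.

Lemma star_decomposition v :
  v = col_mx (usubmx v) (alpha *m usubmx v) + col_mx 0 (star v).
Proof. by rewrite add_col_mx addr0 /star [X in col_mx _ X]addrC subrK vsubmxK. Qed.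

Lemma proj_rhoE v : proj_rho Y v = col_mx (usubmx v) (alpha *m usubmx v).
Proof.
have [_ _ EF _ _] := cutY.
rewrite {1}(star_decomposition v); apply: complementary_proj => //.
- exact: graph_mem.
- by apply/mem_F_rho; exists (star v).
Qed.

Lemma rho_setP (S : set 'cV[R]_d) v :
  rho_set Y S v <-> star v = 0 /\ S (usubmx v).
Proof.
split=> [[_ [x Sx <-] <-]|[v0 Sv]].
  by rewrite proj_rhoE star_col_mx subrr /embed !col_mxKu.
exists (embed m (usubmx v)); first by exists (usubmx v).
rewrite proj_rhoE /embed col_mxKu; apply/esym.
by rewrite {1}(star_decomposition v) v0 col_mx0 addr0.
Qed.

Lemma windowE : window Y = [set col_mx 0 x | x in unit_cube].
Proof.
rewrite cubeY; apply/seteqP; split=> [_ [t tP <-]|_ [x xP <-]].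
  by exists (\col_i t i); rewrite ?sum_delta_rshift // => i; rewrite mxE.
exists (fun i => x i 0) => //; rewrite sum_delta_rshift; congr col_mx.
by apply/matrixP => i j; rewrite mxE ord1.
Qed.

(** The strip is invariant under translation by E, so [v] can be replaced by its F_rho-component
    [col_mx 0 (star v)], where the window is known. *)
Lemma stripP v : strip Y v <-> unit_cube (star v).
Proof.
have stripD w e : strip Y w -> star e = 0 -> strip Y (w + e).
  move=> [w0 w0W [e0 e0E <-]] eE; exists w0 => //; exists (e0 + e); last first.
    by rewrite addrA.
  by rewrite /= in e0E *; apply: memvD; [exact: e0E|exact/mem_physical].
have gr x : star (col_mx x (alpha *m x)) = 0 by rewrite star_col_mx subrr.
split=> [sv|cv].
  have : window Y (col_mx 0 (star v)).
    split; last by apply/mem_F_rho; exists (star v).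
    rewrite (_ : col_mx _ _ = v + - col_mx (usubmx v) (alpha *m usubmx v)).
      by apply: stripD => //; rewrite starN gr oppr0.
    by rewrite {2}(star_decomposition v) [X in X - _]addrC addrK.
  by rewrite windowE => -[x xc /eq_col_mx [_ <-]].
rewrite (star_decomposition v) addrC; apply: stripD => //.
have : window Y (col_mx 0 (star v)) by rewrite windowE; exists (star v).
by case.
Qed.

Lemma proj_pi_inj z z' : lattice z -> lattice z' ->
  proj_pi Y z = proj_pi Y z' -> z = z'.
Proof. by have [_ _ _ inj _] := cutY => lz lz'; apply: inj; apply: mem_set. Qed.

Lemma proj_piD v w : proj_pi Y (v + w) = proj_pi Y v + proj_pi Y w.
Proof. exact: linearD. Qed.

Lemma proj_piB v w : proj_pi Y (v - w) = proj_pi Y v - proj_pi Y w.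
Proof. exact: linearB. Qed.

Lemma lift_ptE z : lattice z -> lift_pt Y (proj_pi Y (z + shiftY)) = z.
Proof.
move=> lz; rewrite /lift_pt; case: xgetP => [w _ [lw e]|/(_ z)[]//].
by apply: proj_pi_inj => //; move: e; rewrite !proj_piD => /addIr.
Qed.

(** The lattice points above points of [Y]; as [proj_pi] is injective on the lattice, they
    correspond bijectively to those points. *)
Definition lift_ok z := lattice z /\ unit_cube (star (z + shiftY)).

Lemma pointsP y :
  points Y y <-> exists z, lift_ok z /\ y = proj_pi Y (z + shiftY).
Proof.
split=> [[x [sz [z lz zx]] <-]|[z [[lz cz] ->]]].
  by exists z; rewrite zx; split=> //; split=> //; apply/stripP; rewrite zx.
by exists (z + shiftY) => //; split; [apply/stripP|exists z].
Qed.

Lemma patchP z Omega y : lift_ok z ->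
  patch Y (proj_pi Y (z + shiftY)) Omega y <->
  exists z', [/\ lift_ok z', y = proj_pi Y (z' + shiftY) &
                 Omega (usubmx (z' - z))].
Proof.
have gr x : star (col_mx x (alpha *m x)) = 0 by rewrite star_col_mx subrr.
move=> [lz cz]; split=> [[/pointsP[z' [lz' ->]]]|[z' [lz' -> O]]].
  rewrite !lift_ptE //; last by case: lz'.
  by move=> /rho_setP[_]; rewrite proj_rhoE col_mxKu => O; exists z'.
split; first by apply/pointsP; exists z'.
rewrite !lift_ptE //; last by case: lz'.
by apply/rho_setP; rewrite proj_rhoE col_mxKu gr.
Qed.

(** Injectivity of [proj_pi] on the lattice turns the equality of translated patches into an
    equality of the sets of lattice vectors v for which [z1 + v], respectively [z2 + v], is again a
    lift. *)
Lemma patch_equivP z1 z2 Omega : lift_ok z1 -> lift_ok z2 ->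
  patch_equiv Y Omega (proj_pi Y (z1 + shiftY)) (proj_pi Y (z2 + shiftY)) <->
  forall v, lattice v -> Omega (usubmx v) ->
    (unit_cube (star (z1 + shiftY) + star v) <->
     unit_cube (star (z2 + shiftY) + star v)).
Proof.
move=> l1 l2.
have okD z v : lift_ok z -> lattice v ->
    lift_ok (z + v) <-> unit_cube (star (z + shiftY) + star v).
  move=> [lz _] lv; rewrite -starD addrAC; split=> [[]//|h].
  by split=> //; apply: latticeD.
have alg (a b v z s : 'cV[R]_(d + m)) :
    z + s + (a + s) - (b + s) = a + v + s -> z = b + v.
  move=> /matrixP e; apply/matrixP => i j; move: (e i j); rewrite !mxE.
  by move=> ?; lra.
have transl z z' z'' v : lattice z -> lattice z' -> lattice z'' -> lattice v ->
    proj_pi Y (z' + shiftY) + proj_pi Y (z + shiftY) - proj_pi Y (z'' + shiftY)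
    = proj_pi Y (z + v + shiftY) -> z' = z'' + v.
  move=> lz lz' lz'' lv e; apply: proj_pi_inj => //; first exact: latticeD.
  rewrite proj_piD; apply: (alg (proj_pi Y z) _ _ _ (proj_pi Y shiftY)).
  by move: e; rewrite !proj_piD.
have translE z z' v :
    proj_pi Y (z' + v + shiftY) + proj_pi Y (z + shiftY) - proj_pi Y (z' + shiftY)
    = proj_pi Y (z + v + shiftY).
  rewrite -proj_piD -proj_piB; congr (proj_pi Y _).
  by apply/matrixP => i j; rewrite !mxE; ring.
have [lz1 _] := l1; have [lz2 _] := l2.
have subK (z v : 'cV[R]_(d + m)) : z + v - z = v by rewrite addrAC subrr add0r.
have addK (z v : 'cV[R]_(d + m)) : z + (v - z) = v by rewrite addrC subrK.
rewrite /patch_equiv; split=> [e v lv Ov|e].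
- split=> /okD h; apply/okD => //.
    have : patch Y (proj_pi Y (z1 + shiftY)) Omega (proj_pi Y (z1 + v + shiftY)).
      by apply/patchP => //; exists (z1 + v); rewrite subK; split=> //; apply: h.
    rewrite e => -[y /(patchP _ _ l2)[z' [l' -> O']]].
    by move=> /transl <- //; case: l'.
  have : patch Y (proj_pi Y (z2 + shiftY)) Omega (proj_pi Y (z2 + v + shiftY)).
    by apply/patchP => //; exists (z2 + v); rewrite subK; split=> //; apply: h.
  move=> P2; have : patch Y (proj_pi Y (z1 + shiftY)) Omega
      (proj_pi Y (z1 + v + shiftY)) by rewrite e; eexists; [exact: P2|exact: translE].
  move=> /(patchP _ _ l1)[z' [l' e' O']].
  suff -> : z1 + v = z' by [].
  by case: l' => l' _; apply: proj_pi_inj; [exact: latticeD|exact: l'|];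
    move: e'; rewrite !proj_piD => /addIr.
- apply/seteqP; split=> y.
    move=> /(patchP _ _ l1)[z' [l' -> O']]; pose v := z' - z1.
    have [lz' _] := l'; have lv : lattice v by apply: latticeB.
    exists (proj_pi Y (z2 + v + shiftY)); last by rewrite translE addK.
    apply/patchP => //; exists (z2 + v); rewrite subK; split=> //.
    by apply/okD => //; apply/e => //; apply/okD; rewrite ?addK.
  move=> [_ /(patchP _ _ l2)[z' [l' -> O']] <-]; pose v := z' - z2.
  have [lz' _] := l'; have lv : lattice v by apply: latticeB.
  have -> : z' = z2 + v by rewrite addK.
  rewrite translE; apply/patchP => //; exists (z1 + v); rewrite subK; split=> //.
  by apply/okD => //; apply/e => //; apply/okD; rewrite ?addK.
Qed.

(** [proj_pi] fixes E, so the difference is a linear function of [star z], bounded on the cube.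
    Regions are tested at points of [Y] but lattice lifts are counted or constructed; [B] is the
    price of passing between them. *)
Lemma usubmx_proj_pi_bound : exists B : R, forall z i, unit_cube (star z) ->
  `|usubmx (proj_pi Y z) i 0 - usubmx z i 0| <= B.
Proof.
pose P (j : 'I_m) := usubmx (proj_pi Y (col_mx 0 (delta_mx j 0))).
exists (\sum_i \sum_j `|P j i 0|) => z i cz.
have [_ [_ EF] _ _ _] := cutY.
have col0E x : col_mx 0 x = \sum_j x j 0 *: col_mx 0 (delta_mx j 0) :> 'cV[R]_(d + m).
  rewrite {1}(matrix_sum_delta x) exchange_big big_ord1.
  apply: (big_ind2 (fun u v => col_mx 0 u = v)) => [|u v u' v' <- <-|j _].
  - by rewrite col_mx0.
  - by rewrite add_col_mx addr0.
  - by rewrite scale_col_mx scaler0.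
have -> : usubmx (proj_pi Y z) i 0 - usubmx z i 0 = \sum_j star z j 0 * P j i 0.
  have gE := daddv_pi_id EF (graph_mem (usubmx z)).
  rewrite {1}(star_decomposition z) proj_piD [proj_pi Y (col_mx (usubmx z) _)]gE.
  rewrite linearD /= col_mxKu mxE addrAC subrr add0r col0E.
  rewrite /proj_pi !linear_sum /= summxE; apply: eq_bigr => j _.
  by rewrite !linearZ /= mxE.
apply: (le_trans (ler_norm_sum _ _ _)); rewrite (bigD1 i) //=.
apply: ler_wpDr; first by apply: sumr_ge0 => j _; apply: sumr_ge0.
apply: ler_sum => j _; rewrite normrM ler_piMl //.
by have /andP[c0 c1] := cz j; rewrite ger0_norm // ltW.
Qed.

End GraphCutAndProject.

(** * Linear repetitivity forces rational dependence *)

(** The bound 1 / (1 + sum of the 1 / F i) also serves an empty index type. *)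
Lemma finite_pos_lower_bound (R : realType) (I : finType) (F : I -> R) :
  (forall i, 0 < F i) -> exists2 e, 0 < e & forall i, e <= F i.
Proof.
move=> F0; have S0 : 0 <= \sum_i (F i)^-1 by apply: sumr_ge0 => i _; rewrite invr_ge0 ltW.
exists (1 + \sum_i (F i)^-1)^-1; first by rewrite invr_gt0 ltr_wpDr.
move=> i; rewrite -[leRHS]invrK lef_pV2 ?posrE ?invr_gt0 ?ltr_wpDr //.
rewrite (bigD1 i) //=.
have : 0 <= \sum_(j | j != i) (F j)^-1 by apply: sumr_ge0 => j _; rewrite invr_ge0 ltW.
lra.
Qed.

Lemma colD (V : zmodType) n (a b : 'cV[V]_n) i : (a + b) i 0 = a i 0 + b i 0.
Proof. by rewrite mxE. Qed.

Lemma colB (V : zmodType) n (a b : 'cV[V]_n) i : (a - b) i 0 = a i 0 - b i 0.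
Proof. by rewrite !mxE. Qed.

(** * Total irrationality as a density statement in Euclidean space *)

Section TorusDensity.
Variables (R : realType) (d m : nat).
Local Notation k := (d + m)%N.

Lemma torus_projP (v w : 'cV[R]_k) :
  torus_proj v = torus_proj w <-> lattice (v - w).
Proof.
rewrite /lattice /torus_proj /=.
split=> [/eqP|h]; last by apply/eqP; rewrite eqmodE.
by rewrite eqmodE.
Qed.

Lemma totally_irrationalP (E : {vspace 'cV[R]_(d + m)}) : totally_irrational E <->
  forall (v : 'cV[R]_k) e, 0 < e -> exists x z, [/\ x \in E, lattice z &
    forall i, `|(x - z) i 0 - v i 0| < e].
Proof.
split=> [dE v e e0|h O [q Oq] oO].
- pose A : set 'cV[R]_k := (ball v e)^°.
  (* The image of [A] in the torus, written so that its preimage is the union of the lattice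
     translates of [A], hence open. *)
  pose O := [set q | exists w z, [/\ lattice z, A (w - z) & q = torus_proj w]].
  have oO : open O.
    suff : open (\pi_(quotient_topology (torus R k)) @^-1` O)%qT by [].
    have -> : (\pi_(quotient_topology (torus R k)) @^-1` O)%qT =
        \bigcup_(z in @lattice R k) ((fun w => w - z) @^-1` A).
      apply/seteqP; split=> w.
        move=> [w' [z [lz b /torus_projP lw]]].
        exists (w - w' + z); first exact: latticeD.
        have wE : w - (w - w' + z) = w' - z by apply/matrixP => i j; rewrite !mxE; ring.
        by rewrite /preimage /= wE.
      by move=> [z lz b]; exists w, z.
    apply: bigcup_open => z _; rewrite openE => w /= Aw.
    have /nbhs_ballP[r r0 rA] : nbhs (w - z) A.
      by apply: open_nbhs_nbhs; split=> //; exact: open_interior.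
    apply/nbhs_ballP; exists r => // w' [_ ww']; apply: rA; split=> // i j.
    by have := ww' i j; rewrite /ball /= !mxE opprB addrA subrK.
  have [|_ [[w [z [lz b ->]]] [x xE /torus_projP lx]]] := dE O _ oO.
    exists (torus_proj v), v, 0; split=> //.
      by apply/latticeP => i; rewrite mxE.
    by rewrite subr0; apply/nbhs_ballP; exists e.
  exists x, (x - w + z); split=> //; first exact: latticeD.
  move=> i; have [_ /(_ i 0)] := interior_subset b.
  by rewrite /ball /= distrC; congr (`|_| < _); rewrite !mxE; ring.
- have [v vq] : exists v, q = torus_proj v.
    by exists (repr q); rewrite /torus_proj reprK.
  have oO' : open (@torus_proj R k @^-1` O) by exact: oO.
  have /nbhs_ballP[r r0 rO] : nbhs v (@torus_proj R k @^-1` O).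
    by apply: open_nbhs_nbhs; split=> //; rewrite /preimage /= -vq.
  have [x [z [xE lz xz]]] := h v r r0.
  exists (torus_proj (x - z)); split.
    by apply: rO; split=> // i j; rewrite ord1 /ball /= distrC; exact: xz.
  exists x => //; apply/torus_projP; rewrite opprB addrC subrK //.
Qed.

End TorusDensity.

Lemma star_small (R : realType) (d m : nat) (alpha : 'M[R]_(m, d)) (e : R) : 0 < e ->
  exists2 r, 0 < r & forall w : 'cV_(d + m), (forall j, `|w j 0| < r) ->
    forall i, `|star alpha w i 0| < e.
Proof.
move=> e0; pose B := 1 + \sum_i \sum_j `|alpha i j|.
have B0 : 0 < B.
  by rewrite /B ltr_wpDr ?ltr01 //; apply: sumr_ge0 => i _; apply: sumr_ge0.
exists (e / B); first exact: divr_gt0.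
move=> w wB i; rewrite /star !mxE; apply: (le_lt_trans (ler_normB _ _)).
apply: (@le_lt_trans _ _ (`|w (rshift d i) 0| + \sum_j `|alpha i j| * (e / B))).
  rewrite lerD2l; apply: (le_trans (ler_norm_sum _ _ _)); apply: ler_sum => j _.
  by rewrite normrM ler_wpM2l // mxE ltW.
rewrite -mulr_suml.
apply: (@lt_le_trans _ _ (e / B + (\sum_j `|alpha i j|) * (e / B))).
  by rewrite ltrD2r.
rewrite -[X in X + _]mul1r -mulrDl mulrCA ger_pMr // ler_pdivrMr // mul1r.
rewrite /B lerD2l [leRHS](bigD1 i) //= lerDl.
by apply: sumr_ge0 => i' _; apply: sumr_ge0.
Qed.

(** [star] is continuous and its kernel is E, so density of E modulo the lattice amounts to density
    of the [star] image of the lattice. *)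
Lemma totally_irrational_graphP (R : realType) (d m : nat) (alpha : 'M[R]_(m, d))
    (Y : cps R d m) :
  [set` physical Y] = [set col_mx x (alpha *m x) | x in setT] ->
  totally_irrational (physical Y) <->
  forall (t : 'cV[R]_m) e, 0 < e -> exists2 z, lattice z &
    forall i, `|star alpha z i 0 - t i 0| < e.
Proof.
move=> physE; split=> [/totally_irrationalP h t e e0|h].
- have [r r0 rP] := star_small alpha e0.
  have [x [z [xE lz xz]]] := h (- col_mx 0 t) r r0.
  exists z => // i.
  have -> : star alpha z i 0 - t i 0 =
      - (star alpha (x - z - - col_mx 0 t) i 0).
    rewrite !starD !starN opprK star_col_mx mulmx0 subr0.
    by move/(mem_physical physE): xE => ->; rewrite !mxE; ring.
  by rewrite normrN; apply: rP => j; have := xz j; rewrite !mxE.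
(* The point of E above the horizontal part of v + z has horizontal error 0, and vertical error
   -(star z + star v). *)
- apply/totally_irrationalP => v e e0.
  have [z lz zv] := h (- star alpha v) e e0.
  exists (col_mx (usubmx (v + z)) (alpha *m usubmx (v + z))), z; split=> //.
    exact: (graph_mem physE).
  move=> i; case: (split_ordP i) => j ->.
    by rewrite [(col_mx _ _ - z) _ _]mxE col_mxEu !mxE addrK subrr normr0.
  have := zv j; rewrite -normrN; congr (`|_| < _).
  rewrite [(col_mx _ _ - z) _ _]mxE col_mxEd !mxE.
  have -> : \sum_l alpha j l * usubmx (v + z) l 0 =
    \sum_l alpha j l * usubmx v l 0 + \sum_l alpha j l * usubmx z l 0.
    by rewrite -big_split /=; apply: eq_bigr => l _; rewrite !mxE mulrDr.
  ring.
Qed.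

(** * Counting patches *)

Section LinearRepetitivityForcesRank.
Variables (R : realType) (d : nat) (alpha : 'M[R]_d) (Y : cps R d d).
Hypothesis physicalE :
  [set` physical Y] = [set col_mx x (alpha *m x) | x in setT].
Hypothesis cutY : is_cut_and_project Y.
Hypothesis cubeY : cubical_window Y.
Hypothesis irrY : totally_irrational (physical Y).
Hypothesis repY : LR_Omega Y (@pointed_integer_rectangles R d).

(** If the i-th row is rational with common denominator q, the i-th coordinate of [star] maps the
    lattice into the multiples of 1 / q, which are not dense. *)
Lemma row_irrational i : exists j, forall a b : int,
  a%:~R + b%:~R * alpha i j = 0 -> b = 0.
Proof.
apply: contrapT => nex.
have rat j : exists ab : int * int, 0 < ab.2 /\ ab.1%:~R + ab.2%:~R * alpha i j = 0.
  apply: contrapT => nj; apply: nex; exists j => a b ab.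
  apply: contrapT => b0; apply: nj.
  have [b1|b1|//] := ltgtP b 0.
    exists (- a, - b); split=> /=; first by rewrite oppr_gt0.
    by rewrite !intrN mulNr -opprD ab oppr0.
  by exists (a, b).
have [ab abP] := choice rat.
pose q := \prod_j (ab j).2.
have q0 : 0 < q by apply: prodr_gt0 => j _; case: (abP j).
have qa j : (q%:~R * alpha i j) \is a Num.int.
  rewrite /q (bigD1 j) //= [X in X%:~R]mulrC intrM -mulrA.
  have /(canRL (addKr _)) -> := (abP j).2.
  by rewrite addr0 rpredM ?rpredN ?intr_int.
have qR : 0 < q%:~R :> R by rewrite ltr0z.
(* Approximating 1 / (2 q) to within 1 / (4 q) would put an integer within 1/4 of 1/2. *)
have [z lz /(_ i)] := (totally_irrational_graphP physicalE).1 irrY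
  (const_mx (2 * q%:~R)^-1) (4 * q%:~R)^-1 ltac:(by rewrite invr_gt0 mulr_gt0).
rewrite [const_mx _ _ _]mxE => zq.
have : q%:~R * star alpha z i 0 \is a Num.int.
  rewrite !mxE mulrBr rpredB //.
    by rewrite rpredM ?intr_int //; exact: (latticeP z).1.
  rewrite mulr_sumr rpred_sum // => j _; rewrite mulrA rpredM //.
  by rewrite mxE; exact: (latticeP z).1.
move=> /intrP[n nE].
have : `|n%:~R - 2^-1| < 4^-1 :> R.
  rewrite -nE (_ : _ - _ = q%:~R * (star alpha z i 0 - (2 * q%:~R)^-1)); last first.
    by field; rewrite gt_eqF.
  rewrite normrM gtr0_norm // -ltr_pdivlMl //.
  by apply: (lt_le_trans zq); rewrite invfM mulrC.
rewrite ltr_norml => /andP[n1 n2].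
have : 0 < n%:~R :> R by lra.
have : n%:~R < 1%:~R :> R by rewrite (_ : 1%:~R = 1) //; lra.
by rewrite ltr_int ltr0z; lia.
Qed.


Local Notation shiftY := (Defs.shift Y).
Local Notation star := (star alpha).

Definition same_patch (Omega : set 'cV[R]_d) (x x' : 'cV[R]_d) :=
  forall v, lattice v -> Omega (usubmx v) ->
    (unit_cube (x + star v) <-> unit_cube (x' + star v)).

(** The fractional part of (alpha p)_i cannot separate x_i from x'_i. The lattice vector over [p]
    that brings x' - alpha p back into the cube sends the i-th coordinate of [x] to x_i minus that
    fractional part, which is negative. *)
Lemma same_patch_floor Omega x x' (p : 'cV[R]_d) i : same_patch Omega x x' ->
  unit_cube x' -> lattice p -> Omega p ->
  let u := (alpha *m p) i 0 in
  x i 0 < u - (Num.floor u)%:~R <= x' i 0 -> False.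
Proof.
move=> sp cx' lp Op u /andP[xu ux'].
pose k : 'cV[R]_d := \col_j (- Num.floor ((x' - alpha *m p) j 0))%:~R.
have lv : lattice (col_mx p k) by apply: lattice_col_mx => //; apply: lattice_intr.
have /sp : Omega (usubmx (col_mx p k)) by rewrite col_mxKu.
move=> /(_ lv) [_ h].
have /h /(_ i) : unit_cube (x' + star (col_mx p k)).
  move=> j; rewrite star_col_mx addrCA colD [k j 0]mxE intrN.
  by have := Num.Theory.floor_itv ((x' - alpha *m p) j 0); rewrite intrD => /andP[]; lra.
have -> : (x + star (col_mx p k)) i 0 = x i 0 - u - (Num.floor (x' i 0 - u))%:~R.
  rewrite star_col_mx colD colB [k _ _]mxE colB intrN -/u.
  by rewrite addrCA [RHS]addrC addrA.
have -> : Num.floor (x' i 0 - u) = - Num.floor u.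
  apply: Num.Theory.floor_def; have /andP[? ?] := cx' i.
  have /andP[? ?] := Num.Theory.floor_itv u.
  by rewrite intrD intrN; lra.
by rewrite intrN; lra.
Qed.

(** Over a given horizontal part each vertical coordinate is an integer confined to a half-open
    interval of length 1. Lifts in a region are thus at most as many as the points of Z^d in it. *)
Lemma lift_ok_inj z z' : lift_ok alpha Y z -> lift_ok alpha Y z' ->
  usubmx z = usubmx z' -> z = z'.
Proof.
move=> [lz cz] [lz' cz'] e.
rewrite -[z]vsubmxK -[z']vsubmxK e; congr col_mx.
have : lattice (dsubmx z - dsubmx z') by apply: latticeB; apply: lattice_dsubmx.
move=> /latticeP h; apply/matrixP => i j; rewrite ord1.
have := h i; move=> /intrP[n nE].
have sE : star (z + shiftY) i 0 - star (z' + shiftY) i 0 = n%:~R.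
  by rewrite -nE !starD /star e !mxE; ring.
have := cz i; have := cz' i; move=> /andP[? ?] /andP[? ?].
have n1 : n%:~R < 1%:~R :> R by rewrite (_ : 1%:~R = 1) //; lra.
have n2 : (-1)%:~R < n%:~R :> R by rewrite (_ : (-1)%:~R = -1) //; lra.
rewrite !ltr_int in n1 n2.
have n0 : n = 0 by lia.
by move: nE; rewrite n0 !mxE => ?; lra.
Qed.

(** Otherwise 1 and the two entries would be independent in the sense of [indep]. Each of the (N +
    1)^(d + 1) elements of [T] then gives its own vector of fractional parts, one for each row, and
    these vectors give distinct patches of shape [0, 2 N]^d. Repetitivity realizes all of them at no
    more than (D N)^d lifts with [D] independent of [N], a contradiction for N = D^d. *)
Lemma row_dependent i0 j1 j2 :
  (forall a b : int, a%:~R + b%:~R * alpha i0 j1 = 0 -> b = 0) ->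
  exists a b c : int, c != 0 /\
    a%:~R + b%:~R * alpha i0 j1 + c%:~R * alpha i0 j2 = 0.
Proof.
move=> irr1; apply: contrapT => nex.
have indep a b c : a%:~R + b%:~R * alpha i0 j1 + c%:~R * alpha i0 j2 = 0 -> c = 0.
  move=> e; apply/eqP/negPn/negP => c0; apply: nex; by exists a, b, c.
have [J0 J0P] := choice row_irrational.
pose J i := if i == i0 then j1 else J0 i.
have JP i a b : a%:~R + b%:~R * alpha i (J i) = 0 -> b = 0.
  by rewrite /J; case: eqP => [->|_]; [exact: irr1|exact: J0P].
have [C C0 rep] := repY.
have [B bB] := usubmx_proj_pi_bound physicalE cutY.
pose S := \sum_j `|usubmx shiftY j 0|.
have sS j : `|usubmx shiftY j 0| <= S.
  by rewrite /S (bigD1 j) //= lerDl; apply: sumr_ge0.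
(* Exceeds the horizontal distance, in each coordinate, from a point of [Y] to its unshifted
   lift. *)
pose B1 := (Num.truncn (`|B| + S)).+1.
have B1P : `|B| + S < B1%:R by rewrite truncnS_gt.
pose D := (Num.truncn (2 * C + 2 * B1%:R + 1)).+1.
have DP : 2 * C + 2 * B1%:R + 1 < D%:R by rewrite truncnS_gt.
(* Chosen so that (D N)^d = N * N^d, which is less than (N + 1)^(d + 1). *)
pose N := (D ^ d)%N.
have N0 : (0 < N)%N by rewrite expn_gt0.
have NR : 1 <= N%:R :> R by rewrite ler1n.
pose T : finType := ({ffun 'I_d -> 'I_N.+1} * 'I_N.+1)%type.
pose pvec i (t : T) : 'cV[R]_d :=
  (t.1 i)%:R *: delta_mx (J i) 0 + (if i == i0 then t.2 : nat else 0)%:R *: delta_mx j2 0.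
pose u i t := (alpha *m pvec i t) i 0.
have uE i t : u i t = (t.1 i)%:R * alpha i (J i) +
    (if i == i0 then t.2 : nat else 0)%:R * alpha i j2.
  by rewrite /u /pvec mulmxDr -!scalemxAr -!colE !mxE.
pose fr i t := u i t - (Num.floor (u i t))%:~R.
have fr01 i t : 0 <= fr i t < 1.
  by have := Num.Theory.floor_itv (u i t); rewrite intrD /fr => /andP[]; lra.
(* Row i0 gives the second component by independence; the first then follows row by row from the
   irrationality of [alpha i (J i)]. *)
have fr_inj t t' : (forall i, fr i t = fr i t') -> t = t'.
  move=> frE; pose a i := Num.floor (u i t') - Num.floor (u i t).
  pose g (x : T) i : nat := if i == i0 then x.2 : nat else 0%N.
  have rel i : (a i)%:~R + ((t.1 i : nat)%:Z - (t'.1 i : nat)%:Z)%:~R * alpha i (J i) +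
      ((g t i)%:Z - (g t' i)%:Z)%:~R * alpha i j2 = 0.
    have := frE i; rewrite /fr /a !uE -/(g t i) -/(g t' i).
    rewrite !intrB -!pmulrn; lra.
  have g0 : g t i0 = g t' i0.
    by have := rel i0; rewrite /J eqxx => /indep; lia.
  have gE i : g t i = g t' i by rewrite /g; case: eqP g0 => // _; rewrite /g eqxx.
  have f0 i : t.1 i = t'.1 i.
    apply: val_inj; have := rel i; rewrite gE subrr mul0r addr0 => /JP /=; lia.
  move: g0; rewrite /g eqxx => g0.
  rewrite [t]surjective_pairing [t']surjective_pairing; congr pair; last exact: val_inj.
  exact/ffunP.
(* Side 2 N because both summands of [pvec] may fall into the same coordinate. *)
pose Omega := box (0 : 'cV[R]_d) (const_mx (2 * N%:R)).
have pOmega i t : lattice (pvec i t) /\ Omega (pvec i t).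
  have pE j : pvec i t j 0 = (t.1 i * (j == J i) +
      (if i == i0 then t.2 : nat else 0) * (j == j2))%:R.
    by rewrite !mxE !andbT natrD !natrM.
  split; first by apply/latticeP => j; rewrite pE intr_nat.
  move=> j; rewrite pE !mxE ler0n /= -natrM ler_nat mul2n -addnn.
  have := ltn_ord (t.1 i); have := ltn_ord t.2.
  by case: (j == J i); case: (j == j2); case: (i == i0) => /=; lia.
have OmegaP : pointed_integer_rectangles Omega.
  split; last by move=> j; rewrite !mxE lexx mulr_ge0.
  exists 0, (const_mx (2 * N%:R)); split=> //; last first.
    move=> v vP; apply/latticeP => j; case: (vP j) => ->; rewrite !mxE.
      by rewrite rpred0.
    by rewrite -natrM natr_int.
  exists (const_mx N%:R); apply/nbhs_ballP; exists 1 => //= x [_ xb] j.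
  have := xb j 0; rewrite /ball /= !mxE ltr_norml => /andP[? ?].
  by apply/andP; split; lra.
(* With this [e] the intervals [fr, fr + e) of each row lie in [0, 1), and those of different values
   are disjoint. Total irrationality then gives a lift [z t] with coordinates in the intervals of
   [t]. *)
have [e e0 eP] : exists2 e, 0 < e & forall i t,
    fr i t + e <= 1 /\ forall t', fr i t < fr i t' -> fr i t + e <= fr i t'.
  pose F (x : 'I_d * T * T) := let: (i, t, t') := x in
    Num.min (1 - fr i t) (if fr i t < fr i t' then fr i t' - fr i t else 1).
  have [[[i t] t']|e e0 eF] := @finite_pos_lower_bound R _ F.
    rewrite /F lt_min subr_gt0; have /andP[_ ->] := fr01 i t => /=.
    by case: ifP => //; rewrite subr_gt0.
  exists e => // i t; split=> [|t' tt'].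
    by have := eF (i, t, t); rewrite /F le_min => /andP[]; lra.
  by have := eF (i, t, t'); rewrite /F le_min tt' => /andP[]; lra.
have exz t : exists z, lift_ok alpha Y z /\
    forall i, fr i t <= star (z + shiftY) i 0 < fr i t + e.
  have [z lz zP] := (totally_irrational_graphP physicalE).1 irrY
    (\col_i (fr i t + e / 2) - star shiftY) (e / 2) ltac:(by rewrite divr_gt0).
  have zt i : fr i t <= star (z + shiftY) i 0 < fr i t + e.
    have := zP i; rewrite starD (colB _ (star shiftY)) (colD (star z)).
    by rewrite [(\col__ _) _ _]mxE ltr_norml; lra.
  exists z; split=> //; split=> // i; have := zt i; have [? _] := eP i t.
  by have := fr01 i t; lra.
have [z zP] := choice exz.
have exw t : exists w, lift_ok alpha Y w /\
    [/\ same_patch Omega (star (w + shiftY)) (star (z t + shiftY)),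
     lattice (usubmx w) & forall j, 0 <= usubmx w j 0 + B1%:R < (D * N)%:R].
  have [zt _] := zP t.
  have py : points Y (proj_pi Y (z t + shiftY)).
    by apply/(pointsP physicalE) => //; exists (z t).
  have [y' [/(pointsP physicalE cubeY)[w [okw ->]] inC
    /(patch_equivP physicalE cutY cubeY _ okw zt) sp]] := rep Omega OmegaP _ py 0.
  exists w; split=> //; have [lw cw] := okw; split=> //; first exact: lattice_usubmx.
  move=> j; move/(rho_setP physicalE cutY): inC => [_ [x xO xE]].
  have := bB (w + shiftY) j cw; rewrite -xE addr0 mxE.
  have -> : usubmx (w + shiftY) j 0 = usubmx w j 0 + usubmx shiftY j 0.
    by rewrite !mxE.
  have := sS j; have := ler_norm B; have := xO j; rewrite !mxE => /andP[x0 x1].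
  move: (usubmx w j 0) (usubmx shiftY j 0) => a s.
  have : 0 <= C * x j 0 by rewrite mulr_ge0 // ltW.
  have : C * x j 0 <= C * (2 * N%:R) by rewrite ler_pM2l.
  rewrite natrM.
  have : D%:R * N%:R >= (2 * C + 2 * B1%:R + 1) * N%:R by rewrite ler_wpM2r // ltW.
  have : 2 * B1%:R * N%:R >= 2 * B1%:R :> R by rewrite ler_peMr.
  rewrite !ler_norml => *; lra.
have [w wP] := choice exw.
pose hh t j := Num.truncn (usubmx (w t) j 0 + B1%:R).
have hlt t j : (hh t j < D * N)%N.
  have [_ [_ _ /(_ j)/andP[w0 w1]]] := wP t.
  by rewrite -(ltr_nat R); apply: le_lt_trans w1; rewrite truncn_le.
pose h t : {ffun 'I_d -> 'I_(D * N)} := [ffun j => Ordinal (hlt t j)].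
(* Equal positions mean equal lifts, so [z t] and [z t'] have the same patch. But if fr i t < fr i
   t', the value fr i t' separates their i-th coordinates, against [same_patch_floor]. *)
have h_inj : injective h.
  move=> t t' hE.
  have wE : w t = w t'.
    have [okt [_ lt wt]] := wP t; have [okt' [_ lt' wt']] := wP t'.
    apply: lift_ok_inj => //; apply/matrixP => j k; rewrite ord1.
    have := congr1 (fun f : {ffun _ -> _} => nat_of_ord (f j)) hE; rewrite !ffunE /=.
    have nn x : lattice (usubmx x) -> 0 <= usubmx x j 0 + B1%:R ->
        usubmx x j 0 + B1%:R \is a Num.nat.
      move=> /latticeP lx x0; rewrite natrEint x0 rpredD ?natr_int //; exact: lx.
    move=> /(congr1 (fun n : nat => n%:R : R)); rewrite !truncnK ?nn //.
    - by move=> /addIr.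
    - by have /andP[] := wt' j.
    - by have /andP[] := wt j.
  apply: fr_inj => i; apply/eqP; rewrite eq_le !leNgt.
  have [_ [st _ _]] := wP t; have [_ [st' _ _]] := wP t'.
  have [okt zt] := zP t; have [okt' zt'] := zP t'.
  rewrite wE in st.
  have sz : same_patch Omega (star (z t + shiftY)) (star (z t' + shiftY)).
    by move=> v lv Ov; rewrite -(st v lv Ov) -(st' v lv Ov).
  have sz' : same_patch Omega (star (z t' + shiftY)) (star (z t + shiftY)).
    by move=> v lv Ov; rewrite (sz v lv Ov).
  apply/andP; split; apply/negP => lt.
  - have [lp Op] := pOmega i t; apply: (same_patch_floor sz' _ lp Op (i := i)).
      by case: okt.
    rewrite -/(u i t) -/(fr i t); have [_ /(_ _ lt)] := eP i t'.
    by have := zt i; have := zt' i; lra.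
  - have [lp Op] := pOmega i t'; apply: (same_patch_floor sz _ lp Op (i := i)).
      by case: okt'.
    rewrite -/(u i t') -/(fr i t'); have [_ /(_ _ lt)] := eP i t.
    by have := zt i; have := zt' i; lra.
have := leq_card _ h_inj.
rewrite card_prod !card_ffun !card_ord expnMn -/N.
have d0 : (0 < d)%N := leq_ltn_trans (leq0n _) (ltn_ord i0).
have : (N ^ d <= N.+1 ^ d)%N by rewrite leq_exp2r.
have : (0 < N.+1 ^ d)%N by rewrite expn_gt0.
by nia.
Qed.

End LinearRepetitivityForcesRank.

(** * Upper bound for the Hausdorff dimension *)

Section HausdorffMeasure.
Context {R : realType} {T : Type} (dist : T -> T -> R).
Implicit Types (s e delta : R) (A U : set T).

Lemma gauge_term_ge0 s U : (0 <= gauge_term dist s U)%E.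
Proof. by rewrite /gauge_term; case: pselect => //= ?; exact: poweR_ge0. Qed.

Lemma diam_ge0 U : (0 <= diam dist U)%E.
Proof. by apply: ereal_sup_ubound; left. Qed.

Lemma diam_le U (r : R) : 0 <= r -> (forall x y, U x -> U y -> dist x y <= r) ->
  (diam dist U <= r%:E)%E.
Proof.
move=> r0 h; apply: ge_ereal_sup => _ [->|[[x y] [/= Ux Uy] <-]].
  by rewrite lee_fin.
by rewrite lee_fin; exact: h.
Qed.

Lemma le_diam U x y : U x -> U y -> ((dist x y)%:E <= diam dist U)%E.
Proof. by move=> Ux Uy; apply: ereal_sup_ubound; right; exists (x, y). Qed.

Lemma gauge_term_le s U (r : R) : 0 <= s -> (diam dist U <= r%:E)%E ->
  (gauge_term dist s U <= (r `^ s)%:E)%E.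
Proof.
move=> s0 Ur; rewrite /gauge_term; case: pselect => /= ?.
  by rewrite lee_fin powR_ge0.
rewrite -poweR_EFin; apply: gt0_ler_poweR => //.
  by rewrite in_itv /= diam_ge0 leey.
by rewrite in_itv /= leey andbT; exact: le_trans (diam_ge0 U) Ur.
Qed.

Definition small_cover s delta e A : Prop := exists U : nat -> set T,
  [/\ A `<=` \bigcup_i U i, forall i, (diam dist (U i) <= delta%:E)%E &
      (\sum_(0 <= i <oo) gauge_term dist s (U i) <= e%:E)%E].

(** Countable subadditivity: the n-th set gets a cover of weight at most e / 2^(n + 1), and the
    doubly indexed family is enumerated through a bijection of nat with nat * nat. *)
Lemma small_cover_bigcup s delta (B : nat -> set T) :
  (forall n e, 0 < e -> small_cover s delta e (B n)) ->
  forall e, 0 < e -> small_cover s delta e (\bigcup_n B n).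
Proof.
move=> h e e0.
have en n : 0 < e / (2 ^ n.+1)%:R by rewrite divr_gt0 // ltr0n expn_gt0.
have [U UP] := choice (fun n => h n _ (en n)).
have /card_set_bijP[f fbij] := card_esym card_nat2.
exists (fun k => U (f k).1 (f k).2); split.
- move=> x [n _ Bx]; have [Bn _ _] := UP n; have [i _ Ux] := Bn x Bx.
  have [_ _ fsurj] := fbij; have [k _ fk] := fsurj (n, i) I.
  by exists k => //; rewrite fk.
- by move=> k; have [_ Ud _] := UP (f k).1; exact: Ud.
have g0 n i : (0 <= gauge_term dist s (U n i))%E by exact: gauge_term_ge0.
rewrite nneseries_esumT //.
rewrite -(@reindex_esum _ _ _ _ _ f (fun p => gauge_term dist s (U p.1 p.2)) fbij).
rewrite (_ : [set: nat * nat] = [set: nat] `*`` (fun=> setT)); last first.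
  by apply/seteqP; split=> -[].
rewrite -(esum_esum (a := fun n i => gauge_term dist s (U n i))) //.
apply: le_trans (epsilon_trick0 predT (ltW e0)).
rewrite nneseries_esumT; last by move=> n; rewrite lee_fin divr_ge0 ?ltW.
apply: le_esum => n _; rewrite -nneseries_esumT //.
by have [_ _] := UP n.
Qed.

Lemma hausdorff_measure0 s A :
  (forall delta e, 0 < delta -> 0 < e -> small_cover s delta e A) ->
  hausdorff_measure dist s A = 0%E.
Proof.
move=> h; apply/eqP; rewrite eq_le; apply/andP; split.
  apply: ge_ereal_sup => _ [delta /= delta0 <-].
  apply/lee_addgt0Pr => e e0; rewrite add0e.
  have [U [AU Ud Us]] := h delta e delta0 e0.
  by apply: le_trans Us; apply: ereal_inf_lbound; exists U.
apply: (@le_trans _ _ (hausdorff_premeasure dist s 1 A)).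
  apply: le_ereal_inf_tmp => _ [U _ <-].
  by apply: nneseries_ge0 => i _ _; exact: gauge_term_ge0.
by apply: ereal_sup_ubound; exists 1 => /=.
Qed.

End HausdorffMeasure.

Lemma nneseries_le_card {R : realType} (u : nat -> \bar R) (K : nat) (c : R) :
  0 <= c -> (forall i, (0 <= u i)%E) -> (forall i, (i < K)%N -> (u i <= c%:E)%E) ->
  (forall i, (K <= i)%N -> u i = 0%E) ->
  (\sum_(0 <= i <oo) u i <= (K%:R * c)%:E)%E.
Proof.
move=> c0 u0 uc uK; apply: lime_le; first exact: is_cvg_nneseries.
apply: nearW => n.
apply: (@le_trans _ _ ((minn n K)%:R * c)%:E); last first.
  by rewrite lee_fin ler_wpM2r // ler_nat geq_minr.
elim: n => [|n IH]; first by rewrite big_nil min0n mul0r.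
rewrite big_nat_recr //=; have [nK|Kn] := ltnP n K.
  rewrite (minn_idPl nK) -natr1 mulrDl mul1r EFinD leeD //; last exact: uc.
  by move: IH; rewrite (minn_idPl (ltnW nK)).
rewrite uK // adde0; apply: le_trans IH _.
by rewrite lee_fin ler_wpM2r // ler_nat (minn_idPr Kn) leq_min leqnn andbT leqW.
Qed.

(** * Covers of Lipschitz images of unit cubes of dimension d *)

Section RationalPieces.
Variables (R : realType) (d : nat).
Implicit Types (q r : 'M[rat]_d).

Definition rational_rows q r (t : 'I_d -> R) : 'M[R]_d :=
  \matrix_(i, j) (ratr (r i j) + ratr (q i j) * t i).

(** The integer vector [v] confines the parameter to a unit cube, so that a piece is bounded while
    the pieces remain countably many. *)
Definition rational_piece q r (v : {ffun 'I_d -> int}) : set 'M[R]_d :=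
  [set alpha | exists t, (forall i, 0 <= t i - (v i)%:~R < 1) /\
     alpha = rational_rows q r t].

Lemma euclid_dist_le (A B : 'M[R]_d) (c : R) : 0 <= c ->
  (forall i j, `|A i j - B i j| <= c) -> euclid_dist A B <= d%:R * c.
Proof.
move=> c0 h; rewrite /euclid_dist.
rewrite -[leRHS]ger0_norm ?mulr_ge0 // -sqrtr_sqr ler_wsqrtr //.
apply: (@le_trans _ _ (\sum_(i < d) \sum_(j < d) c ^+ 2)).
  apply: ler_sum => i _; apply: ler_sum => j _.
  by rewrite -[leLHS]ger0_norm ?sqr_ge0 // normrX lerXn2r ?nnegrE.
rewrite !sumr_const !card_ord (_ : _ *+ d *+ d = (d%:R * c) ^+ 2) //.
by ring.
Qed.

(** Cutting the parameter cube into N^d cubes of side 1 / N gives sets of diameter at most L / N,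
    with total weight at most L^s N^(d - s), which tends to 0. *)
Lemma rational_piece_small_cover q r v (s delta e : R) :
  d%:R < s -> 0 < delta -> 0 < e ->
  small_cover euclid_dist s delta e (rational_piece q r v).
Proof.
move=> ds delta0 e0.
have s0 : 0 < s by apply: le_lt_trans ds.
have sd0 : 0 < s - d%:R by rewrite subr_gt0.
pose Q : R := \sum_i \sum_j `|ratr (q i j)|.
have Qij i j : `|ratr (q i j)| <= Q :> R.
  rewrite /Q (bigD1 i) //= (bigD1 j) //= -addrA lerDl addr_ge0 //.
    by apply: sumr_ge0.
  by apply: sumr_ge0 => i' _; apply: sumr_ge0.
have Q0 : 0 <= Q by apply: sumr_ge0 => i' _; apply: sumr_ge0.
(* A Lipschitz constant of [rational_rows q r] from the maximum norm; the 1 keeps it positive when q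
   = 0. *)
pose L : R := d%:R * Q + 1.
have L0 : 0 < L by rewrite /L ltr_wpDl // mulr_ge0.
pose c := L `^ s / e.
have c0 : 0 < c by rewrite divr_gt0 // powR_gt0.
(* The first summand makes the total weight at most [e], the second the diameters at most
   [delta]. *)
pose N := (Num.truncn (c `^ (s - d%:R)^-1 + L / delta)).+1.
have NP : c `^ (s - d%:R)^-1 + L / delta < N%:R by rewrite truncnS_gt.
have N0 : 0 < N%:R :> R by rewrite ltr0n.
have N1 : L / N%:R <= delta.
  rewrite ler_pdivrMr // mulrC -ler_pdivrMr //.
  by apply/ltW; apply: le_lt_trans NP; rewrite lerDr powR_ge0.
have N2 : c <= N%:R `^ (s - d%:R).
  rewrite -[leLHS](@powRr1 R) ?(ltW c0) //.
  rewrite -[X in c `^ X](@mulVf _ (s - d%:R)) ?gt_eqF // powRrM.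
  apply: ge0_ler_powR; rewrite ?(ltW sd0) // ?nnegrE ?powR_ge0 //.
  by apply: le_trans (ltW NP); rewrite lerDl divr_ge0 // ltW.
pose I : finType := {ffun 'I_d -> 'I_N}.
pose S (f : I) : set 'M[R]_d := [set alpha | exists t,
  (forall i, 0 <= t i - ((v i)%:~R + (f i)%:R / N%:R) <= N%:R^-1) /\
     alpha = rational_rows q r t].
pose U (i : nat) : set 'M[R]_d :=
  if insub i is Some k then S (enum_val (k : 'I_#|I|)) else set0.
have diamS f : (diam euclid_dist (S f) <= (L / N%:R)%:E)%E.
  apply: diam_le => [|_ _ [t [tP ->]] [t' [tP' ->]]]; first by rewrite divr_ge0 ?ltW.
  apply: (@le_trans _ _ (d%:R * (Q / N%:R))).
    apply: euclid_dist_le => [|i j]; first by rewrite divr_ge0.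
    rewrite !mxE [X in `|X|](_ : _ = ratr (q i j) * (t i - t' i)); last by ring.
    rewrite normrM ler_pM // ler_norml.
    by have := tP i; have := tP' i; lra.
  by rewrite mulrA ler_pM2r ?invr_gt0 // /L lerDl.
have diamU i : (diam euclid_dist (U i) <= (L / N%:R)%:E)%E.
  rewrite /U; case: insubP => [k _ _|_]; first exact: diamS.
  by apply: diam_le => // ; rewrite divr_ge0 ?ltW.
exists U; split.
- move=> _ [t [tv ->]].
  pose g i := Num.truncn (N%:R * (t i - (v i)%:~R)).
  have gP i : (g i < N)%N /\ (g i)%:R <= N%:R * (t i - (v i)%:~R) <= (g i)%:R + 1.
    have /andP[t0 t1] := tv i.
    have x0 : 0 <= N%:R * (t i - (v i)%:~R) by rewrite mulr_ge0 // ltW.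
    have /andP[g1 g2] := truncn_itv x0; split.
      by rewrite truncn_lt_nat // gtr_pMr.
    by rewrite g1 natr1 ltW.
  pose f : I := [ffun i => Ordinal (gP i).1].
  exists (enum_rank f) => //; rewrite /U.
  case: insubP => [k _ kE|]; last by rewrite ltn_ord.
  have -> : k = enum_rank f by apply: val_inj.
  rewrite enum_rankK; exists t; split=> // i; rewrite ffunE /=.
  have [_ /andP[g1 g2]] := gP i.
  rewrite opprD addrA.
  rewrite -(ler_pM2l N0) -[X in _ && X](ler_pM2l N0) mulr0 mulfV ?gt_eqF //.
  by rewrite mulrBr [N%:R * (_ / _)]mulrC divfK ?gt_eqF //; lra.
- by move=> i; apply: le_trans (diamU i) _; rewrite lee_fin.
apply: (@le_trans _ _ (#|I|%:R * (L / N%:R) `^ s)%:E).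
  apply: nneseries_le_card => [|i|i _|i iK].
  - exact: powR_ge0.
  - exact: gauge_term_ge0.
  - by apply: gauge_term_le; [exact: ltW|exact: diamU].
  rewrite /U; case: insubP => [k|_]; first by rewrite ltnNge iK.
  by rewrite /gauge_term; case: pselect.
rewrite lee_fin card_ffun !card_ord natrX -powR_mulrn ?(ltW N0) //.
rewrite powRM ?invr_ge0 ?(ltW L0) ?(ltW N0) // -powR_inv1 ?(ltW N0) //.
rewrite -powRrM mulN1r mulrCA.
rewrite -powRD; last by rewrite (gt_eqF N0) implybT.
rewrite -[d%:R - s]opprB powRN.
rewrite ler_pdivrMr ?powR_gt0 // mulrC -ler_pdivrMr //.
Qed.

End RationalPieces.

(** In each row an irrational entry [alpha i (J i)] serves as the parameter; [row_dependent] has a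
    nonzero coefficient at any other entry and can be solved for it. *)
Lemma LR_cubical_params_rational (R : realType) (d : nat) (alpha : 'M[R]_d) :
  LR_cubical_params alpha -> exists q r v, rational_piece q r v alpha.
Proof.
move=> [Y [physE [cutY _ irrY _ cubeY] repY]].
have [J JP] := choice (row_irrational physE irrY).
have dep i j : exists qr : rat * rat,
    alpha i j = ratr qr.2 + ratr qr.1 * alpha i (J i).
  have [a [b [c [c0 abc]]]] := row_dependent physE cutY cubeY irrY repY j (JP i).
  have cR : c%:~R != 0 :> R by rewrite intr_eq0.
  exists (- b%:~R / c%:~R, - a%:~R / c%:~R) => /=.
  rewrite !fmorph_div !rmorphN /= !ratr_int.
  have -> : alpha i j = - (a%:~R + b%:~R * alpha i (J i)) / c%:~R.
    by apply/(canRL (mulfK cR)); rewrite mulrC; lra.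
  by field.
have [F FP] := choice (fun ij : 'I_d * 'I_d => dep ij.1 ij.2).
exists (\matrix_(i, j) (F (i, j)).1), (\matrix_(i, j) (F (i, j)).2).
exists [ffun i => Num.floor (alpha i (J i))], (fun i => alpha i (J i)); split.
  by move=> i; rewrite ffunE; have := Num.Theory.floor_itv (alpha i (J i));
    rewrite intrD => /andP[]; lra.
by apply/matrixP => i j; rewrite !mxE; exact: FP (i, j).
Qed.

Lemma hausdorff_dim_LR_cubical_params_le (R : realType) (d : nat) :
  (hausdorff_dim euclid_dist (@LR_cubical_params R d) <= d%:R%:E)%E.
Proof.
apply/lee_addgt0Pr => e e0; rewrite -EFinD.
apply: ereal_inf_lbound; exists (d%:R + e) => //; split; first by rewrite addr_ge0 // ltW.
apply: hausdorff_measure0 => delta e' delta0 e'0.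
pose X : countType := ('M[rat]_d * 'M[rat]_d * {ffun 'I_d -> int})%type.
(* The pieces enumerated by codes of their indices; numbers that code nothing get the empty set. *)
pose B (n : nat) : set 'M[R]_d :=
  if (unpickle n : option X) is Some (q, r, v) then rational_piece q r v else set0.
have [|U [BU Ud Us]] := @small_cover_bigcup R _ euclid_dist (d%:R + e) delta B _ e' e'0.
  move=> n e2 e20; rewrite /B; case: (unpickle n) => [[[q r] v]|].
    by apply: rational_piece_small_cover => //; rewrite ltrDl.
  exists (fun=> set0); split=> //.
    by move=> _; apply: diam_le => //; exact: ltW.
  rewrite eseries0 ?lee_fin ?ltW // => i _ _.
  by rewrite /gauge_term; case: pselect.
exists U; split=> // alpha /LR_cubical_params_rational[q [r [v qrv]]].
by apply: BU; exists (pickle ((q, r, v) : X)) => //; rewrite /B pickleK.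
Qed.

(** * Lower bound for the Hausdorff dimension *)

Lemma card_family_prod (I J : finType) (F : I -> {set J}) :
  #|family (fun i => mem (F i))| = (\prod_i #|F i|)%N.
Proof.
rewrite -sum1_card.
under [RHS]eq_bigr => i _ do rewrite -sum1_card.
by rewrite bigA_distr_big_dep /=; apply: eq_bigr => f _; rewrite big1.
Qed.

(** * Badly approximable points outside a cover of small weight *)

Section CantorSet.
Variables (R : realType) (d : nat).

Definition child_near (x e r : R) (j : nat) : Prop :=
  exists2 u, x + j%:R * e <= u <= x + j%:R * e + e & `|u - r| < e.

(** Only the subinterval containing [r] and its two neighbours can qualify. *)
Lemma card_child_near (M : nat) (x r e : R) : 0 < e ->
  (#|[set j : 'I_M | `[< child_near x e r j >]]%SET| <= 3)%N.
Proof.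
move=> e0; set A := [set j | _]%SET.
pose m := Num.floor ((r - x) / e).
have jm (j : 'I_M) : j \in A -> m - 1 <= j%:Z <= m + 1.
  rewrite inE => /asboolP[u /andP[u1 u2] ur].
  have /andP[m1 m2] : m%:~R * e <= r - x < (m%:~R + 1) * e.
    have := Num.Theory.floor_itv ((r - x) / e).
    by rewrite ler_pdivlMr // ltr_pdivrMr // intrD.
  move: ur; rewrite ltr_norml => /andP[ur1 ur2].
  have j1 : m%:~R * e < (j%:Z + 2)%:~R * e.
    by rewrite intrD -pmulrn; lra.
  have j2 : j%:Z%:~R * e < (m + 2)%:~R * e.
    by rewrite intrD -pmulrn; lra.
  by rewrite !ltr_pM2r // !ltr_int in j1 j2; lia.
pose f (j : 'I_M) : 'I_3 := inord (absz (j%:Z - (m - 1))%R).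
have fE j : j \in A -> f j = absz (j%:Z - (m - 1))%R :> nat.
  by move=> /jm h; rewrite inordK //; move: h; clear; lia.
have finj : {in A &, injective f}.
  move=> i j iA jA /(congr1 val) /=; rewrite !fE //.
  by move: (jm _ iA) (jm _ jA) => h1 h2 h; apply: val_inj => /=; lia.
by rewrite -(card_in_imset finj) -[X in (_ <= X)%N](card_ord 3) max_card.
Qed.


Variable M : nat.
Hypothesis M4 : (3 < M)%N.

Definition mesh (k : nat) : R := M%:R^-1 ^+ k.

Lemma base_gt0 : 0 < M%:R :> R. Proof. by rewrite ltr0n; case: M M4. Qed.

Lemma mesh_gt0 k : 0 < mesh k.
Proof. by rewrite exprn_gt0 // invr_gt0 base_gt0. Qed.

Lemma meshS k : M%:R * mesh k.+1 = mesh k.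
Proof. by rewrite /mesh exprS mulrA mulfV ?mul1r // gt_eqF // base_gt0. Qed.

(** A denominator q is first treated at the level where M^k reaches 4 q^2; the radius [mesh k.+1] is
    then comparable to 1 / q^2, as bad approximability requires. *)
Definition bad_child (k : nat) (x : R) (j : nat) : Prop :=
  exists u (p q : int), [/\ x + j%:R * mesh k.+1 <= u <= x + j%:R * mesh k.+1 + mesh k.+1,
    0 < q, 4 * q%:~R ^+ 2 <= M%:R ^+ k :> R &
    `|u - p%:~R / q%:~R| < mesh k.+1].

(* Distinct rationals with 4 q ^ 2 <= M ^ k are at distance at least
   4 / M ^ k, so at most one of them is close to a given interval of length
   1 / M ^ k. *)
Lemma card_bad_child k x :
  (#|[set j : 'I_M | `[< bad_child k x j >]]%SET| <= 3)%N.
Proof.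
have [[j0 [u0 [p0 [q0 [u0P q00 q0M u0r]]]]]|nb] :=
    pselect (exists j : 'I_M, bad_child k x j); last first.
  rewrite (_ : [set j : 'I_M | `[< bad_child k x j >]]%SET = finset.set0) ?cards0 //.
  apply/setP => j; rewrite finset.in_set finset.in_set0.
  apply/negbTE/asboolP => h; apply: nb.
  by exists j.
apply: leq_trans (card_child_near M x (p0%:~R / q0%:~R) (mesh_gt0 k.+1)).
apply/subset_leq_card/fintype.subsetP => j; rewrite !finset.in_set.
move=> /asboolP[u [p [q [uP qp qM ur]]]].
apply/asboolP; exists u => //.
suff -> : p0%:~R / q0%:~R = p%:~R / q%:~R :> R by [].
have qR : 0 < q%:~R :> R by rewrite ltr0z.
have q0R : 0 < q0%:~R :> R by rewrite ltr0z.
have in_cell (i : 'I_M) v : x + i%:R * mesh k.+1 <= v <= x + i%:R * mesh k.+1 + mesh k.+1 ->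
    x <= v <= x + mesh k.
  move=> /andP[v1 v2]; apply/andP; split.
    by apply: le_trans v1; rewrite lerDl mulr_ge0 // ltW // mesh_gt0.
  apply: (le_trans v2); rewrite -addrA lerD2l -(meshS k).
  rewrite -[X in _ + X]mul1r -mulrDl natr1 ler_pM2r ?mesh_gt0 // ler_nat.
  exact: ltn_ord.
have /andP[a1 a2] := in_cell _ _ u0P; have /andP[b1 b2] := in_cell _ _ uP.
have mk : mesh k.+1 <= mesh k.
  by rewrite -(meshS k) ler_peMl ?(ltW (mesh_gt0 _)) // ler1n; case: M M4.
have D : `|p%:~R / q%:~R - p0%:~R / q0%:~R| < 4 * mesh k :> R.
  by move: ur u0r; rewrite !ltr_norml => /andP[? ?] /andP[? ?]; lra.
have [e|ne] := eqVneq (p * q0 - p0 * q) 0.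
  move/eqP: e; rewrite subr_eq0 => /eqP e.
  apply/eqP; rewrite eqr_div ?(gt_eqF qR) ?(gt_eqF q0R) //.
  by rewrite -(intrM _ p0 q) -(intrM _ p q0) e.
have qq : 4 * (q%:~R * q0%:~R) <= M%:R ^+ k :> R.
  have := sqr_ge0 (q%:~R - q0%:~R : R); nra.
have qq0 : 0 < q%:~R * q0%:~R :> R by rewrite mulr_gt0.
have : (q%:~R * q0%:~R)^-1 <= `|p%:~R / q%:~R - p0%:~R / q0%:~R| :> R.
  have -> : p%:~R / q%:~R - p0%:~R / q0%:~R = (p * q0 - p0 * q)%:~R / (q%:~R * q0%:~R) :> R.
    by rewrite intrB !intrM; field; rewrite (gt_eqF qR) (gt_eqF q0R).
  rewrite normrM normfV (gtr0_norm qq0) ler_peMl ?invr_ge0 ?(ltW qq0) //.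
  by rewrite -intr_norm ler1z; move: (_ - _) ne; clear => z; lia.
move=> /le_lt_trans/(_ D); rewrite /mesh exprVn.
rewrite -ltr_pdivrMr ?invr_gt0 ?exprn_gt0 ?base_gt0 // invrK mulrC.
by rewrite ltr_pdivrMr // => ?; lra.
Qed.

Variable s : R.
Hypothesis s0 : 0 < s.
Hypothesis M_large : 3 ^+ d * M%:R `^ s <= (M - 3)%:R ^+ d.

Variables (V : nat -> set ('I_d -> R)) (w : nat -> R).
Hypothesis w0 : forall n, 0 < w n.
Hypothesis Vdiam : forall n a b i, V n a -> V n b -> `|a i - b i| `^ s <= w n.

Definition cell (k : nat) (x : 'I_d -> R) : set ('I_d -> R) :=
  [set a | forall i, x i <= a i <= x i + mesh k].

(** The weight of a set of the size of the next generation: a lighter member of the cover is shorter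
    than a child in every direction. *)
Definition threshold (k : nat) : R := mesh k.+1 `^ s.

Definition cell_weight (k : nat) (x : 'I_d -> R) (n : nat) : R :=
  w n * `[< V n `&` cell k x !=set0 >]%:R.

Definition potential (k : nat) (x : 'I_d -> R) : \bar R :=
  (\sum_(0 <= n <oo) (cell_weight k x n)%:E)%E.

Lemma cell_weight_ge0 k x n : (0 <= (cell_weight k x n)%:E)%E.
Proof. by rewrite lee_fin mulr_ge0 // ltW. Qed.

Lemma cell_weight_le_potential k x n : ((cell_weight k x n)%:E <= potential k x)%E.
Proof.
apply: le_trans (nneseries_lim_ge n.+1 _); last by move=> *; exact: cell_weight_ge0.
rewrite big_nat_recr //= leeDr // sume_ge0 // => i _; exact: cell_weight_ge0.
Qed.

Lemma thresholdS k : threshold k = M%:R `^ s * threshold k.+1.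
Proof. by rewrite /threshold -powRM ?meshS ?ler0n // ltW // mesh_gt0. Qed.

Definition child (k : nat) (x : 'I_d -> R) (f : 'I_d -> 'I_M) : 'I_d -> R :=
  fun i => x i + (f i)%:R * mesh k.+1.

Lemma child_le k x f i : child k x f i + mesh k.+1 <= x i + mesh k.
Proof.
rewrite /child -addrA lerD2l -(meshS k) -[X in _ + X]mul1r -mulrDl natr1.
rewrite ler_pM2r ?mesh_gt0 // ler_nat; exact: ltn_ord.
Qed.

Lemma cell_child k x f : cell k.+1 (child k x f) `<=` cell k x.
Proof.
move=> a ax i; have /andP[a1 a2] := ax i; apply/andP; split.
  by apply: le_trans a1; rewrite lerDl mulr_ge0 // ltW // mesh_gt0.
exact: le_trans a2 (child_le k x f i).
Qed.

(** If [V n] meets the cell, its weight is below the threshold, so it is shorter than [mesh k.+1] in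
    every direction and meets at most 3^d children. *)
Lemma sum_cell_weight k x (G : {pred {ffun 'I_d -> 'I_M}}) n :
  (potential k x < (threshold k)%:E)%E ->
  \sum_(f in G) cell_weight k.+1 (child k x f) n <= 3 ^+ d * cell_weight k x n.
Proof.
move=> small.
have [[a [Va ax]]|none] := pselect (V n `&` cell k x !=set0); last first.
  rewrite big1 => [|f _].
    by apply: mulr_ge0; [exact: exprn_ge0|rewrite -lee_fin; exact: cell_weight_ge0].
  rewrite /cell_weight asboolF ?mulr0 // => -[b [Vb /cell_child bx]].
  by apply: none; exists b.
have wE : cell_weight k x n = w n by rewrite /cell_weight asboolT ?mulr1 //; exists a.
have wn : w n < threshold k.
  by rewrite -lte_fin -wE; apply: le_lt_trans small; exact: cell_weight_le_potential.
pose F (i : 'I_d) := [set j : 'I_M | `[< child_near (x i) (mesh k.+1) (a i) j >]]%SET.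
have near b i : V n b -> `|b i - a i| < mesh k.+1.
  move=> Vb; rewrite ltNge; apply/negP => h.
  have := le_lt_trans (Vdiam i Vb Va) wn; rewrite ltNge => /negP; apply.
  by apply: ge0_ler_powR; rewrite ?nnegrE ?(ltW s0) ?(ltW (mesh_gt0 _)).
rewrite wE -mulr_sumr mulrC ler_pM2r //.
apply: (@le_trans _ _ (\sum_(f in family (fun i => mem (F i))) 1)).
  rewrite [leLHS]big_mkcond [leRHS]big_mkcond /=; apply: ler_sum => f _.
  case: ifP => // _; last by case: ifP.
  case: asboolP => [[b [Vb bx]]|_]; last by case: ifP.
  rewrite ifT //; apply/familyP => i; rewrite inE; apply/asboolP.
  by exists (b i); [exact: bx|exact: near].
rewrite sumr_const card_family_prod -natrX ler_nat.
apply: (@leq_trans (\prod_(i < d) 3)%N); last by rewrite prod_nat_const card_ord.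
by apply: leq_prod => i _; apply: card_child_near; exact: mesh_gt0.
Qed.

Definition good_child k (x x' : 'I_d -> R) : Prop :=
  [/\ (potential k.+1 x' < (threshold k.+1)%:E)%E,
    forall i, x i <= x' i, forall i, x' i + mesh k.+1 <= x i + mesh k &
    forall a i (p q : int), cell k.+1 x' a -> 0 < q ->
      4 * q%:~R ^+ 2 <= M%:R ^+ k :> R -> mesh k.+1 <= `|a i - p%:~R / q%:~R|].

(** Averaging. At least (M - 3)^d children avoid the rationals in all coordinates. If none of them
    had small potential, (M - 3)^d threshold(k + 1) would be at most 3^d potential(k), which is less
    than 3^d M^s threshold(k + 1), contradicting [M_large]. *)
Lemma good_child_exists k x : (potential k x < (threshold k)%:E)%E ->
  exists x', good_child k x x'.
Proof.
move=> small.
pose F (i : 'I_d) := (~: [set j : 'I_M | `[< bad_child k (x i) j >]])%SET.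
pose G := family (fun i => mem (F i)).
have cardG : ((M - 3) ^ d <= #|G|)%N.
  rewrite card_family_prod.
  apply: (@leq_trans (\prod_(i < d) (M - 3))%N); first by rewrite prod_nat_const card_ord.
  apply: leq_prod => i _; rewrite cardsCs finset.setCK card_ord.
  by apply: leq_sub2l; exact: card_bad_child.
have [f [fG fsmall]] : exists f, f \in G /\
    (potential k.+1 (child k x f) < (threshold k.+1)%:E)%E.
  apply: contrapT => nf.
  have big f : f \in G -> ((threshold k.+1)%:E <= potential k.+1 (child k x f))%E.
    by move=> fG; rewrite leNgt; apply/negP => h; apply: nf; exists f.
  have th0 j : 0 < threshold j by rewrite powR_gt0 // mesh_gt0.
  have : ((\sum_(f in G) threshold k.+1)%:E <= (3 ^+ d)%:E * potential k x)%E.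
    rewrite -sumEFin; apply: (@le_trans _ _
      (\sum_(f in G) potential k.+1 (child k x f))%E); first exact: lee_sum.
    rewrite -nneseries_sum; last by move=> *; exact: cell_weight_ge0.
    rewrite -nneseriesZl; last by move=> *; exact: cell_weight_ge0.
    apply: lee_nneseries => n _.
      by move=> _; apply: sume_ge0 => f _; exact: cell_weight_ge0.
    by rewrite sumEFin -EFinM lee_fin; exact: sum_cell_weight.
  have p3 : 0 < 3 ^+ d :> R by rewrite exprn_gt0.
  move=> /le_lt_trans /(_ (_ : _ < (3 ^+ d)%:E * (threshold k)%:E)%E).
  rewrite lte_pmul2l // small => /(_ isT); rewrite -EFinM lte_fin sumr_const.
  rewrite -[_ *+ #|_|]mulr_natl (thresholdS k) [ltRHS]mulrA ltr_pM2r //.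
  apply/negP; rewrite -leNgt; apply: (le_trans M_large).
  by rewrite -natrX ler_nat.
exists (child k x f); split=> //.
- by move=> i; rewrite /child lerDl mulr_ge0 // ltW // mesh_gt0.
- exact: child_le.
- move=> a i p q ax q0 qM; rewrite leNgt; apply/negP => h.
  have /familyP/(_ i) := fG; rewrite finset.in_setC finset.in_set => /asboolP; apply.
  by exists (a i), p, q; split=> //; exact: ax.
Qed.

(** Iterating [good_child_exists] from the unit cube gives nested cells with a common point. Avoided
    rationals make it badly approximable, and a set [V n] containing it would have positive weight
    below every threshold. *)
Lemma avoiding_point : (\sum_(0 <= n <oo) (w n)%:E < (threshold 0)%:E)%E ->
  exists2 a : 'I_d -> R, forall i, badly_approximable (4 * M%:R ^+ 2)^-1 (a i) &
    forall n, ~ V n a.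
Proof.
move=> wsmall.
have step (kx : nat * ('I_d -> R)) : exists x',
    (potential kx.1 kx.2 < (threshold kx.1)%:E)%E -> good_child kx.1 kx.2 x'.
  case: kx => k x /=.
  have [/good_child_exists[x' x'P]|h] := pselect (potential k x < (threshold k)%:E)%E.
    by exists x'.
  by exists x => /h.
have [next nextP] := choice step.
pose xs := fix xs k : 'I_d -> R := if k is k'.+1 then next (k', xs k') else fun=> 0.
have small k : (potential k (xs k) < (threshold k)%:E)%E.
  elim: k => [|k IH]; last by have [] := nextP (k, xs k) IH.
  apply: le_lt_trans wsmall; apply: lee_nneseries => n _.
    by move=> _; exact: cell_weight_ge0.
  by rewrite lee_fin ler_piMr ?(ltW (w0 n)) // lern1 leq_b1.
have mono k l i : (k <= l)%N -> xs k i <= xs l i /\ xs l i + mesh l <= xs k i + mesh k.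
  move=> /subnK <-; elim: (l - k)%N => [|n [IH1 IH2]] //.
  rewrite addSn /=.
  have [_ /(_ i) /= h1 /(_ i) /= h2 _] :=
    nextP (_, xs (n + k)%N) (small (n + k)%N).
  by split; [exact: le_trans h1|exact: le_trans IH2].
have cellub k l i : xs l i <= xs k i + mesh k.
  have [kl|lk] := leqP k l.
    have [_ h] := mono k l i kl; apply: le_trans h.
    by rewrite lerDl ltW // mesh_gt0.
  have [h _] := mono l k i (ltnW lk); apply: (le_trans h).
  by rewrite lerDl ltW // mesh_gt0.
pose a i := sup (range (fun k => xs k i)).
have acell k : cell k (xs k) a.
  move=> i; apply/andP; split.
    apply: ub_le_sup; last by exists k.
    by exists (xs k i + mesh k) => _ [l _ <-]; exact: cellub.
  apply: ge_sup; first by exists (xs k i), k.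
  by move=> _ [l _ <-]; exact: cellub.
exists a.
- move=> i p q q0.
  have qR : 0 < q%:~R :> R by rewrite ltr0z.
  have q1 : 1 <= q%:~R :> R by rewrite ler1z.
  have M2 : 2 <= M%:R :> R by rewrite ler_nat; case: M M4 => [|[]].
  have ex : exists k, 4 * q%:~R ^+ 2 <= M%:R ^+ k :> R.
    exists (Num.truncn (4 * q%:~R ^+ 2 : R)).+1.
    apply: (le_trans (ltW (truncnS_gt _))); rewrite -natrX ler_nat.
    by apply/ltnW/ltn_expl; case: M M4 => [|[]].
  (* The first level treating q is positive since 4 q^2 > 1. Minimality bounds M^k by 4 q^2, which
     yields the constant 1 / (4 M^2). *)
  have [[|k] kP kmin] := @ex_minnP (fun k => 4 * q%:~R ^+ 2 <= M%:R ^+ k :> R) ex.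
    by move: kP; rewrite expr0; nra.
  have {kmin} kP' : M%:R ^+ k < 4 * q%:~R ^+ 2 :> R.
    by rewrite ltNge; apply/negP => /kmin; rewrite ltnn.
  have [_ _ _ /(_ a i p q)] := nextP (k.+1, xs k.+1) (small k.+1).
  move=> /(_ (acell k.+2) q0 kP) /=.
  have -> : q%:~R * a i - p%:~R = q%:~R * (a i - p%:~R / q%:~R).
    by field; rewrite (gt_eqF qR).
  rewrite normrM (gtr0_norm qR) => h.
  apply: (@le_trans _ _ (q%:~R * mesh k.+2)); last by rewrite ler_pM2l.
  have MkP : 0 < M%:R ^+ k :> R by rewrite exprn_gt0 // base_gt0.
  have M2P : 0 < M%:R ^+ 2 :> R by rewrite exprn_gt0 // base_gt0.
  have mE : mesh k.+2 * M%:R ^+ 2 * M%:R ^+ k = 1.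
    by rewrite -mulrA -exprD /mesh exprVn mulVf // gt_eqF // exprn_gt0 // base_gt0.
  have M24 : 0 < 4 * M%:R ^+ 2 :> R by rewrite mulr_gt0.
  rewrite ler_pdivrMr // -[leLHS]mul1r ler_pdivrMr // -[leLHS]mE.
  rewrite [leRHS](_ : _ = mesh k.+2 * M%:R ^+ 2 * (4 * q%:~R ^+ 2)); last by ring.
  by rewrite ler_pM2l ?ltW //; apply: mulr_gt0; rewrite ?mesh_gt0.
- move=> n Vn.
  have wk k : w n < threshold k.
    rewrite -lte_fin; apply: le_lt_trans (small k).
    apply: le_trans (cell_weight_le_potential _ _ n).
    by rewrite /cell_weight asboolT ?mulr1 //; exists a.
  (* At level k = truncn y, M^(k + 1) > k + 1 > y, so threshold k is at most w n. *)
  pose y := (w n `^ s^-1)^-1.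
  have y0 : 0 < w n `^ s^-1 by rewrite powR_gt0.
  have := wk (Num.truncn y); rewrite ltNge => /negP; apply.
  rewrite -[leRHS]powRr1 ?(ltW (w0 n)) // -[X in _ `^ X](mulVf (lt0r_neq0 s0)) powRrM.
  apply: ge0_ler_powR; rewrite ?(ltW s0) ?nnegrE ?powR_ge0 ?(ltW (mesh_gt0 _)) //.
  rewrite /mesh exprVn -[leRHS]invrK lef_pV2 ?posrE ?invr_gt0 ?exprn_gt0 ?base_gt0 //.
  apply: (le_trans (ltW (truncnS_gt y))); rewrite -natrX ler_nat.
  by apply/ltnW/ltn_expl; case: M M4 => [|[]].
Qed.

End CantorSet.

(** For M >= 6, M - 3 >= M / 2, so it suffices that M^(d - s) >= 6^d. *)
Lemma large_base (R : realType) (d : nat) (s : R) : (0 < d)%N -> s < d%:R ->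
  exists2 M : nat, (3 < M)%N & 3 ^+ d * M%:R `^ s <= (M - 3)%:R ^+ d :> R.
Proof.
move=> d0 sd; have ds0 : 0 < d%:R - s by rewrite subr_gt0.
pose y : R := (6 ^+ d) `^ (d%:R - s)^-1.
pose M := (Num.truncn y + 6)%N.
have My : y <= M%:R.
  by apply: (le_trans (ltW (truncnS_gt y))); rewrite ler_nat -addn1 leq_add2l.
have M6 : (6 <= M)%N by exact: leq_addl.
clearbody M.
have M0 : 0 < M%:R :> R by rewrite ltr0n; lia.
exists M; first by lia.
have h1 : 6 ^+ d <= M%:R `^ (d%:R - s).
  have p6 : 0 <= 6 ^+ d :> R by rewrite exprn_ge0.
  rewrite -[leLHS](powRr1 p6) -[X in _ `^ X <= _](mulVf (lt0r_neq0 ds0)) powRrM.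
  by apply: ge0_ler_powR; rewrite ?(ltW ds0) ?nnegrE ?powR_ge0.
have h2 : M%:R ^+ d <= 2 ^+ d * (M - 3)%:R ^+ d :> R.
  rewrite -exprMn; apply: lerXn2r; rewrite ?nnegrE ?mulr_ge0 //.
  by rewrite -natrM ler_nat; lia.
have h3 : M%:R ^+ d = M%:R `^ s * M%:R `^ (d%:R - s) :> R.
  by rewrite -powRD ?(gt_eqF M0) ?implybT // addrC subrK powR_mulrn // ltW.
have p2 : 0 < 2 ^+ d :> R by rewrite exprn_gt0.
rewrite -(ler_pM2l p2); apply: le_trans h2.
rewrite h3 mulrA -exprMn -natrM mulrC ler_pM2l ?powR_gt0 //.
Qed.

(** If the s-dimensional measure vanished for some s < d, a cover of [A] of small weight, pulled
    back to the diagonal matrices, would miss a badly approximable point by [avoiding_point]. *)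
Lemma le_hausdorff_dim (R : realType) (d : nat) (A : set 'M[R]_d) : (0 < d)%N ->
  (forall c (a : 'I_d -> R), 0 < c <= 1 -> (forall i, badly_approximable c (a i)) ->
     A (diag_mx (\row_i a i))) ->
  (d%:R%:E <= hausdorff_dim euclid_dist A)%E.
Proof.
move=> d0 hA; apply: le_ereal_inf_tmp => _ [s [s0 Hs0] <-].
rewrite lee_fin leNgt; apply/negP => sd.
(* A positive exponent below d even when s = 0. The members of the cover have diameter at most 1, so
   raising the exponent only lowers their weights. *)
pose s' := (s + d%:R) / 2.
have [ss' s'd s'0] : [/\ s < s', s' < d%:R & 0 < s'].
  by rewrite /s'; split; lra.
have [M M3 Ms] := large_base d0 s'd.
pose e := threshold M s' 0 / 2.
have e0 : 0 < e by rewrite divr_gt0 // powR_gt0 // mesh_gt0.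
have : (hausdorff_premeasure euclid_dist s 1 A < e%:E)%E.
  apply: (@le_lt_trans _ _ 0%E); last by rewrite lte_fin.
  by rewrite -Hs0; apply: ereal_sup_ubound; exists 1 => /=.
move=> /ereal_inf_lt[_ [U [AU Ud] <-] Ue].
have gfin n : gauge_term euclid_dist s (U n) \is a fin_num.
  rewrite ge0_fin_numE ?gauge_term_ge0 //.
  by apply: le_lt_trans (gauge_term_le s0 (Ud n)) _; rewrite ltry.
(* The added terms make all weights positive and sum to [e], which keeps the total below threshold 0
   = 2 e. *)
pose w n := fine (gauge_term euclid_dist s (U n)) + e / (2 ^ n.+1)%:R.
have p2 n : 0 < e / (2 ^ n.+1)%:R by rewrite divr_gt0 // ltr0n expn_gt0.
have w0 n : 0 < w n.
  by rewrite ltr_wpDl // fine_ge0 // gauge_term_ge0.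
pose V n : set ('I_d -> R) := [set a | U n (diag_mx (\row_i a i))].
have Vd n a b i : V n a -> V n b -> `|a i - b i| `^ s' <= w n.
  move=> Va Vb; set x := `|a i - b i|.
  have x0 : 0 <= x by exact: normr_ge0.
  have xd : (x%:E <= diam euclid_dist (U n))%E.
    apply: le_trans (@le_diam _ _ euclid_dist (U n) _ _ Va Vb).
    rewrite lee_fin /euclid_dist /x.
    rewrite -sqrtr_sqr ler_wsqrtr // (bigD1 i) //= (bigD1 i) //=.
    rewrite !mxE eqxx !mulr1n -addrA lerDl addr_ge0 //.
      by apply: sumr_ge0 => j _; exact: sqr_ge0.
    by apply: sumr_ge0 => k _; apply: sumr_ge0 => j _; exact: sqr_ge0.
  have x1 : x <= 1 by rewrite -lee_fin; exact: le_trans xd (Ud n).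
  apply: (@le_trans _ _ (x `^ s)).
    have [->|xn0] := eqVneq x 0; first by rewrite powR0 ?powR_ge0 // gt_eqF.
    by apply: ger_powR; [rewrite lt0r xn0 x0 x1|exact: ltW].
  rewrite /w ler_wpDr ?(ltW (p2 _)) // -lee_fin fineK // /gauge_term.
  case: pselect => [U0|Un0] /=; first by move: Va; rewrite /V /= U0.
  rewrite -poweR_EFin; apply: gt0_ler_poweR => //.
    by rewrite in_itv /= lee_fin x0 leey.
  by rewrite in_itv /= leey diam_ge0.
have [|a aB aV] := avoiding_point M3 s'0 Ms w0 Vd.
  apply: (@le_lt_trans _ _ (\sum_(0 <= n <oo) gauge_term euclid_dist s (U n) + e%:E)%E).
    apply: le_trans (epsilon_trick predT
      (fun n => gauge_term_ge0 euclid_dist s (U n)) (ltW e0)).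
    apply: lee_nneseries => n _; first by move=> _; rewrite lee_fin ltW.
    by rewrite /w EFinD fineK.
  have -> : (threshold M s' 0)%:E = (e%:E + e%:E)%E.
    by rewrite -EFinD /e -splitr.
  by rewrite lteD2rE.
have M0 := base_gt0 R M3.
have cP : 0 < (4 * M%:R ^+ 2 : R)^-1 <= 1.
  rewrite invr_gt0 mulr_gt0 ?exprn_gt0 //= invf_le1 ?mulr_gt0 ?exprn_gt0 //.
  have : 1 <= M%:R :> R by rewrite ler1n; lia.
  by move=> ?; nra.
have [n _ Un] := AU _ (hA _ a cP aB).
exact: aV Un.
Qed.

(** * Diagonal parameters *)

Section GraphSpace.
Variables (R : realType) (d : nat) (B : 'M[R]_d).

Definition graph : {vspace 'cV[R]_(d + d)} := limg (linfun (mulmx (col_mx 1%:M B))).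

Lemma mem_graph v : v \in graph <-> exists x, v = col_mx x (B *m x).
Proof.
split=> [/memv_imgP[x _ ->]|[x ->]].
  by exists x; rewrite lfunE /= mul_col_mx mul1mx.
by apply/memv_imgP; exists x; rewrite ?memvf // lfunE /= mul_col_mx mul1mx.
Qed.

Lemma graphE : [set` graph] = [set col_mx x (B *m x) | x in setT].
Proof.
apply/seteqP; split=> v; first by move=> /mem_graph[x ->]; exists x.
by move=> [x _ <-]; apply/mem_graph; exists x.
Qed.

Lemma dim_graph : \dim graph = d.
Proof.
rewrite limg_dim_eq ?dimvf /dim /= ?muln1 //.
apply/eqP; rewrite -subv0; apply/subvP => x.
rewrite memv_cap memv_ker lfunE /= mul_col_mx mul1mx => /andP[_ /eqP e].
by rewrite memv0; move: e => /(congr1 usubmx); rewrite col_mxKu linear0 => ->.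
Qed.

End GraphSpace.

Section DiagonalCutAndProject.
Variables (R : realType) (d : nat) (c : R) (a : 'I_d -> R).
Hypothesis cP : 0 < c <= 1.
Hypothesis bad_a : forall i, badly_approximable c (a i).

Definition diag_alpha : 'M[R]_d := diag_mx (\row_i a i).
(** Slopes of F_pi, with beta - alpha = 1 so that the F_pi-component of v has horizontal part
    [star v]. Projection along F_rho itself would kill the vertical lattice vectors. *)
Definition diag_beta : 'M[R]_d := diag_mx (\row_i (a i + 1)).

Local Notation star := (star diag_alpha).

(** The vertical shift by 1/2 is for regularity: p + 1/2 - a q is never an integer when a is
    irrational. *)
Definition diag_cps : cps R d d := {|
  physical := graph diag_alpha;
  F_pi := graph diag_beta;
  window_pi := [set v | v \in graph diag_beta /\ unit_cube (star v)];
  Defs.shift := col_mx 0 (const_mx 2^-1) |}.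

Local Notation Y := diag_cps.
Local Notation shiftY := (Defs.shift Y).

Lemma diag_mulE (b : 'I_d -> R) (x : 'cV[R]_d) i :
  (diag_mx (\row_i b i) *m x) i 0 = b i * x i 0.
Proof. by rewrite mul_diag_mx !mxE. Qed.

Lemma diag_starE (v : 'cV[R]_(d + d)) i :
  star v i 0 = v (rshift d i) 0 - a i * v (lshift d i) 0.
Proof. by rewrite /star colB diag_mulE !mxE. Qed.

Lemma diag_physicalE :
  [set` physical Y] = [set col_mx x (diag_alpha *m x) | x in setT].
Proof. exact: graphE. Qed.

Lemma diag_betaB (x : 'cV[R]_d) : diag_beta *m x - diag_alpha *m x = x.
Proof. by apply/matrixP => i j; rewrite ord1 colB !diag_mulE; ring. Qed.

Lemma diag_decomposition (v : 'cV[R]_(d + d)) : exists2 e, e \in physical Y &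
  v = e + col_mx (star v) (diag_beta *m star v).
Proof.
exists (v - col_mx (star v) (diag_beta *m star v)); last by rewrite subrK.
apply/(mem_physical diag_physicalE).
by rewrite starD starN star_col_mx diag_betaB subrr.
Qed.

Lemma diag_irrational i (p q : int) : p%:~R + q%:~R * a i = 0 -> q = 0.
Proof. by have /andP[c0 _] := cP; exact: (badly_approximable_irrational c0 (bad_a i)). Qed.

Lemma diag_complementary : complementary (physical Y) (F_pi Y).
Proof.
have physP := mem_physical diag_physicalE.
split.
    apply/vspaceP => v; rewrite memvf; have [e eE ->] := diag_decomposition v.
    apply: memv_add => //; apply/mem_graph; by exists (star v).
  apply/eqP; rewrite -subv0; apply/subvP => v; rewrite memv_cap => /andP[/physP v0].
  move=> /mem_graph[x vE]; move: v0; rewrite vE star_col_mx diag_betaB => ->.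
  by rewrite memv0 mulmx0 col_mx0.
Qed.

Lemma diag_is_cut_and_project : is_cut_and_project Y.
Proof.
have physP := mem_physical diag_physicalE.
have EF := diag_complementary.
split=> //.
- exact: dim_graph.
- split.
    apply/vspaceP => v; rewrite memvf (star_decomposition diag_alpha v).
    apply: memv_add; first exact: (graph_mem diag_physicalE).
    by apply/mem_F_rho; exists (star v).
  apply/eqP; rewrite -subv0; apply/subvP => v; rewrite memv_cap => /andP[/physP v0].
  move=> /mem_F_rho[x vE]; move: v0; rewrite vE star_col_mx mulmx0 subr0 => ->.
  by rewrite memv0 col_mx0.
- move=> z z' /set_mem lz /set_mem lz' e; apply/eqP; rewrite -subr_eq0; apply/eqP.
  have lv : lattice (z - z') by apply: latticeB.
  have {e} : proj_pi Y (z - z') = 0 by rewrite proj_piB e subrr.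
  move: (z - z') lv => v lv; have [e eE vE] := diag_decomposition v.
  rewrite {1}vE /proj_pi complementary_proj //; last first.
    by apply/mem_graph; exists (star v).
  move=> e0; rewrite e0 add0r in vE; move/latticeP: lv => lv.
  (* A lattice vector in F_pi satisfies p = (a + 1) q in each coordinate, so q = 0 by
     irrationality. *)
  have v0 i : v (lshift d i) 0 = 0.
    have /intrP[q qE] := lv (lshift d i); have /intrP[p pE] := lv (rshift d i).
    have := congr1 (fun u : 'cV_(d + d) => u (rshift d i) 0) vE.
    have := congr1 (fun u : 'cV_(d + d) => u (lshift d i) 0) vE.
    rewrite /= col_mxEd col_mxEu diag_mulE => <-; rewrite pE qE => pq.
    have := @diag_irrational i (q - p) q; rewrite intrB => -> //.
    by rewrite pq; ring.
  have s0 : star v = 0.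
    apply/matrixP => i j; rewrite ord1.
    have := congr1 (fun u : 'cV_(d + d) => u (lshift d i) 0) vE.
    by rewrite /= col_mxEu v0 => <-; rewrite mxE.
  by rewrite vE s0 mulmx0 col_mx0.
- by move=> v [].
Qed.

Lemma diag_stripP v : strip Y v <-> unit_cube (star v).
Proof.
have physP := mem_physical diag_physicalE.
split=> [[w [_ cw] [e /physP eE <-]]|cv]; first by rewrite starD eE addr0.
have [e eE vE] := diag_decomposition v.
exists (col_mx (star v) (diag_beta *m star v)); last first.
  by exists e => //; rewrite addrC -vE.
split; first by apply/mem_graph; exists (star v).
by rewrite star_col_mx diag_betaB.
Qed.

Lemma diag_cubical_window : cubical_window Y.
Proof.
rewrite /cubical_window /window; apply/seteqP; split=> v.
  move=> [/diag_stripP cv /mem_F_rho[x vE]]; exists (fun i => x i 0).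
    by move=> i; have := cv i; rewrite vE star_col_mx mulmx0 subr0.
  rewrite sum_delta_rshift vE; congr col_mx.
  by apply/matrixP => i j; rewrite mxE ord1.
move=> [t tP <-]; rewrite sum_delta_rshift.
split; last by apply/mem_F_rho; exists (\col_i t i).
by apply/diag_stripP => i; rewrite star_col_mx mulmx0 subr0 mxE.
Qed.

Lemma diag_star_shift i : star shiftY i 0 = 2^-1.
Proof. by rewrite star_col_mx mulmx0 subr0 mxE. Qed.

(** No coordinate of [star v] is 0 or 1, so a small ball around [v] crosses no face of the strip. If
    it meets the strip it lies inside, so [v] in the closure is interior. *)
Lemma diag_regular : regular Y.
Proof.
rewrite /regular; apply/seteqP; split=> // v [[z /latticeP lz zv] [vc vi]].
have v01 i : star v i 0 != 0 /\ star v i 0 != 1.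
  have /intrP[q qE] := lz (lshift d i); have /intrP[p pE] := lz (rshift d i).
  have vE : star v i 0 = p%:~R + 2^-1 - a i * q%:~R.
    by rewrite -zv starD colD diag_starE diag_star_shift pE qE addrAC.
  have odd_ne (n : int) : star v i 0 <> n%:~R.
    rewrite vE => e; have := @diag_irrational i (2 * (p - n) + 1) (- 2 * q).
    rewrite intrD !intrM intrB => /(_ _)q0.
    have {}q0 : q = 0.
      have : - 2 * q = 0; last by lia.
      by apply: q0; rewrite (_ : (-2)%:~R = -2) //; lra.
    move: e; rewrite q0 mulr0 subr0 => e.
    have : (2 * (n - p))%:~R = 1%:~R :> R by rewrite intrM intrB; lra.
    by move=> /intr_inj; lia.
  by split; apply/eqP; [exact: (odd_ne 0)|exact: (odd_ne 1)].
have [|r r0 rP] := @finite_pos_lower_bound R _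
  (fun i : 'I_d => Num.min `|star v i 0| `|star v i 0 - 1|).
  by move=> i; rewrite lt_min !normr_gt0 subr_eq0; case: (v01 i) => -> ->.
have [r' r'0 r'P] := star_small diag_alpha r0.
have close w : ball v r' w -> forall i, `|star w i 0 - star v i 0| < r.
  move=> [_ vw] i; rewrite -colB -starN -starD; apply: r'P => j.
  by rewrite colB distrC; exact: vw.
have rv i : r <= `|star v i 0| /\ r <= `|star v i 0 - 1|.
  by have := rP i; rewrite le_min => /andP[].
have nb : nbhs v (ball v r') by apply/nbhs_ballP; exists r'.
have [w [/diag_stripP cw /close wv]] := vc _ nb.
apply: vi; apply/nbhs_ballP; exists r' => // w' /close w'v.
apply/diag_stripP => i; have := cw i; have := wv i; have := w'v i.
have [] := rv i; rewrite !ltr_norml !ler_normr => /orP[]? /orP[] ? *; lra.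
Qed.

Lemma diag_totally_irrational : totally_irrational (physical Y).
Proof.
have /andP[c0 c1] := cP.
apply/(totally_irrational_graphP diag_physicalE) => t e e0.
pose Q := (Num.truncn (2 / (c * e))).+1.
have QP : 2 / (c * e) < Q%:R by rewrite truncnS_gt.
have eQ : 2 / (c * Q%:R) < e.
  rewrite ltr_pdivrMr ?mulr_gt0 ?ltr0n //.
  by move: QP; rewrite ltr_pdivrMr ?mulr_gt0 //; lra.
have ex i : exists nm : int * int, `|nm.2%:~R - a i * nm.1%:~R - t i 0| < e.
  have [n [m [_ nm]]] :=
    @inhomogeneous_approximation R c (a i) Q (t i 0) 0 c0 (bad_a i) isT.
  by exists (n, m); exact: le_lt_trans eQ.
have [nm nmP] := choice ex.
exists (col_mx (\col_i (nm i).1%:~R) (\col_i (nm i).2%:~R)).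
  by apply: lattice_col_mx; apply: lattice_intr.
by move=> i; rewrite star_col_mx colB diag_mulE !mxE.
Qed.

(** A period is the projection of a lattice vector z all of whose multiples are lifts. Then 1/2 + k
    star z stays in the cube for all k, so star z = 0, and z = 0 by irrationality. *)
Lemma diag_aperiodic : aperiodic Y.
Proof.
have cutY := diag_is_cut_and_project.
have ptP := pointsP diag_physicalE diag_cubical_window.
have lat0 : lattice (0 : 'cV[R]_(d + d)) by apply/latticeP => i; rewrite mxE.
have ok0 : lift_ok diag_alpha Y 0.
  by split=> // i; rewrite add0r diag_star_shift; lra.
move=> x xE per.
have step y : points Y y -> points Y (y + x) by move=> py; rewrite -per; exists y.
have steps k : points Y (proj_pi Y shiftY + x *+ k).
  elim: k => [|k IH]; last by rewrite mulrS [x + _]addrC addrA; exact: step.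
  by rewrite mulr0n addr0; apply/ptP; exists 0; rewrite add0r.
have /ptP[z [[lz _]]] := steps 1%N.
rewrite mulr1n proj_piD addrC => /addIr xz.
have okk k : lift_ok diag_alpha Y (z *+ k).
  have /ptP[z' [okz']] := steps k; rewrite proj_piD addrC => /addIr e.
  suff -> : z *+ k = z' by [].
  have [lz' _] := okz'.
  apply: (proj_pi_inj cutY) => //; first exact: latticeMn.
  by rewrite -e xz /proj_pi linearMn.
have sz0 i : star z i 0 = 0.
  apply/eqP/negPn/negP => nz; have nz' : 0 < `|star z i 0| by rewrite normr_gt0.
  pose k := (Num.truncn `|star z i 0|^-1).+1.
  have kP : `|star z i 0|^-1 < k%:R by rewrite truncnS_gt.
  have [_ /(_ i)] := okk k.
  have -> : star (z *+ k + shiftY) i 0 = k%:R * star z i 0 + 2^-1.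
    rewrite starD colD diag_star_shift; congr (_ + _).
    by rewrite !diag_starE -scaler_nat !mxE; ring.
  have : 1 < k%:R * `|star z i 0| by rewrite -ltr_pdivrMr // mul1r.
  by rewrite -[k%:R in X in X -> _]ger0_norm // -normrM ltr_normr => /orP[] ? /andP[]; lra.
suff z0 : z = 0 by rewrite xz z0 /proj_pi linear0.
move/latticeP: lz => lz.
have zl i : z (lshift d i) 0 = 0.
  have /intrP[q qE] := lz (lshift d i); have /intrP[p pE] := lz (rshift d i).
  have := sz0 i; rewrite diag_starE pE qE => e.
  rewrite -[q]opprK; have -> : - q = 0; last by rewrite oppr0.
  by apply: (@diag_irrational i p); rewrite intrN; lra.
apply/matrixP => i j; rewrite ord1 [RHS]mxE; case: (split_ordP i) => l -> //.
by have := sz0 l; rewrite diag_starE zl mulr0 subr0.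
Qed.

(** For diagonal alpha the i-th test on a lattice vector involves only its i-th horizontal and
    vertical entries, so [linear_recurrence] is applied in each coordinate with the sides of the
    box, and the resulting integers are assembled into one lift. *)
Lemma diag_LR : LR_Omega Y (@pointed_integer_rectangles R d).
Proof.
have /andP[c0 c1] := cP.
have cutY := diag_is_cut_and_project.
have cubeY := diag_cubical_window.
have ptP := pointsP diag_physicalE cubeY.
have [B bB] := usubmx_proj_pi_bound diag_physicalE cutY.
pose K := 8 / c ^+ 2 + 2.
have K0 : 0 < K by rewrite addr_gt0 // divr_gt0 // exprn_gt0.
have C0 : 0 < K + 2 * `|B| by rewrite ltr_wpDr // mulr_ge0.
exists (K + 2 * `|B|) => // _ [[lo [hi [-> [x0 x0int] vert]]] box0] y.
move=> /ptP[z [okz ->]] t; have [lz cz] := okz.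
have lol : lattice lo by apply: vert => i; left.
have hil : lattice hi by apply: vert => i; right.
pose l i := Num.floor (lo i 0); pose h i := Num.floor (hi i 0).
have lE i : lo i 0 = (l i)%:~R by rewrite /l floorK //; exact: (latticeP lo).1.
have hE i : hi i 0 = (h i)%:~R by rewrite /h floorK //; exact: (latticeP hi).1.
have lh0 i : l i <= 0 <= h i.
  by have := box0 i; rewrite mxE lE hE ler0z lerz0.
(* The box has an interior point, so its integer sides have length at least 1; hence 2 |B| is at
   most 2 |B| (h i - l i). *)
have lh i : l i < h i.
  have /nbhs_ballP[r /= r0 rP] := x0int.
  have xin s : `|s| < r -> lo i 0 <= x0 i 0 + s <= hi i 0.
    move=> sr; have := rP (x0 + s *: delta_mx i 0) _ i.
    rewrite colD !mxE !eqxx mulr1; apply; split=> // i' j'; rewrite /ball /= !mxE.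
    rewrite opprD addrA subrr add0r normrN ord1 eqxx andbT.
    by case: eqP; rewrite ?mulr1 ?mulr0 ?normr0.
  have r2 : `|r / 2| < r by rewrite ger0_norm ?divr_ge0 ?ltW // ltr_pdivrMr //; lra.
  have := xin (r / 2) r2; have := xin (- (r / 2)); rewrite normrN => /(_ r2).
  by rewrite lE hE -(ltr_int R); lra.
pose x := star (z + shiftY).
(* The range for n leaves a margin of |B| at both ends of the side of the translated box, to absorb
   the passage from lift to point. *)
have ex i : exists nm : int * int,
    t i 0 + (K + 2 * `|B|) * lo i 0 + `|B| <= nm.1%:~R
      <= t i 0 + (K + 2 * `|B|) * lo i 0 + `|B| + K * (h i - l i)%:~R /\
    forall p k : int, l i <= p <= h i ->
      (0 <= x i 0 + (k%:~R - a i * p%:~R) < 1) =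
      (0 <= nm.2%:~R + 2^-1 - a i * nm.1%:~R + (k%:~R - a i * p%:~R) < 1).
  have [n [m nmP]] := linear_recurrence 2^-1 (t i 0 + (K + 2 * `|B|) * lo i 0 + `|B|)
    cP (bad_a i) (lh0 i) (lh i) (cz i).
  by exists (n, m).
have [nm nmP] := choice ex.
pose z' : 'cV[R]_(d + d) := col_mx (\col_i (nm i).1%:~R) (\col_i (nm i).2%:~R).
have z'E i : star (z' + shiftY) i 0 = (nm i).2%:~R + 2^-1 - a i * (nm i).1%:~R.
  by rewrite starD colD diag_star_shift star_col_mx colB diag_mulE !mxE addrAC.
(* The test p = k = 0, allowed because the box contains the origin, transfers membership in the cube
   itself. *)
have okz' : lift_ok diag_alpha Y z'.
  split; first by apply: lattice_col_mx; apply: lattice_intr.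
  move=> i; rewrite z'E; have [_ /(_ 0 0 (lh0 i))] := nmP i.
  by rewrite !mulr0 subr0 !addr0 => <-; exact: cz.
exists (proj_pi Y (z' + shiftY)); split.
- by apply/ptP; exists z'.
- apply/(rho_setP diag_physicalE cutY); split.
    by apply/(mem_physical diag_physicalE); exact: memv_pi.
  exists ((K + 2 * `|B|)^-1 *: (usubmx (proj_pi Y (z' + shiftY)) - t)); last first.
    by rewrite scalerA mulfV ?gt_eqF // scale1r subrK.
  move=> i; have [_ cz'] := okz'; have := bB _ i cz'.
  have -> : usubmx (z' + shiftY) i 0 = (nm i).1%:~R.
    by rewrite linearD /= !col_mxKu addr0 mxE.
  have -> : ((K + 2 * `|B|)^-1 *: (usubmx (proj_pi Y (z' + shiftY)) - t)) i 0 =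
      (usubmx (proj_pi Y (z' + shiftY)) i 0 - t i 0) / (K + 2 * `|B|).
    by rewrite mxE colB mulrC.
  move: (usubmx _ i 0) => u; rewrite ler_pdivlMr // ler_pdivrMr //.
  have [/andP[n1 n2] _] := nmP i; have := ler_norm B.
  have : 1 <= (h i - l i)%:~R :> R by rewrite ler1z; have := lh i; lia.
  move: n1 n2; rewrite lE hE intrB ler_norml.
  move: (`|B|) (normr_ge0 B) => b b0 n1 n2 hl bb /andP[u1 u2].
  have : b * 1 <= b * ((h i)%:~R - (l i)%:~R) by rewrite ler_wpM2l.
  by move=> ?; apply/andP; split; lra.
- apply/(patch_equivP diag_physicalE cutY cubeY _ okz' okz) => v lv Ov.
  have key i : (0 <= (x + star v) i 0 < 1) = (0 <= (star (z' + shiftY) + star v) i 0 < 1).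
    have /intrP[q qE] := (latticeP v).1 lv (lshift d i).
    have /intrP[p pE] := (latticeP v).1 lv (rshift d i).
    rewrite (colD x) (colD (star (z' + shiftY))) z'E (diag_starE v) pE qE.
    have [_ ->//] := nmP i.
    by have := Ov i; rewrite mxE qE lE hE !ler_int.
  by split=> h' i; [rewrite key|rewrite -key]; exact: h'.
Qed.

Lemma diag_LR_cubical : LR_cubical_params diag_alpha.
Proof.
exists Y; split; [exact: diag_physicalE| |exact: diag_LR].
split; [exact: diag_is_cut_and_project|exact: diag_regular|
  exact: diag_totally_irrational|exact: diag_aperiodic|exact: diag_cubical_window].
Qed.

End DiagonalCutAndProject.

Theorem theorem1p5 (R : realType) (d : nat) (hd : (1 <= d)%N) :
  hausdorff_dim euclid_dist (@LR_cubical_params R d) = (d%:R)%:E.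
Proof.
apply/eqP; rewrite eq_le; apply/andP; split.
  exact: hausdorff_dim_LR_cubical_params_le.
apply: le_hausdorff_dim => // c a c01 bad_a.
exact: (diag_LR_cubical c01 bad_a).
Qed.
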